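(* Let $\triangle PQR$ be a triangle contained in $D$. If $\delta(P,Q,R)<\Delta'(P,Q)$, then $\frac13<\rho(\psi_{\triangle PQR})<\frac12$. If $\delta(P,Q,R)\ge\Delta'(P,Q)$, then $\rho(\psi_{\triangle PQR})=\frac13$.
   Context: $D$ is the open unit disk in $\mathbb{R}^2$ (Beltrami–Klein model) and $S^1$ its boundary, identified with $\mathbb{R}/\mathbb{Z}$ via $t\mapsto(\cos2\pi t,\sin2\pi t)$; $\pi:\mathbb{R}\to S^1$, $\pi(x)=x-\lfloor x\rfloor$. For $P,Q\in D$ with chord endpoints $v_1,v_2\in S^1$, $d'(P,Q)=\frac12\left|\log\frac{|v_1Q||v_2P|}{|v_1P||v_2Q|}\right|$, $\Delta'(P,Q)=\log\frac{e^{d'(P,Q)}+1}{e^{d'(P,Q)}-1}$, and $\delta(P,Q,R)$ is the minimum of $d'(R,S)$ over points $S\in D$ on the line $PQ$. For a (non-degenerate, closed) triangle $\triangle PQR\subset D$ and $v\in S^1$, there are exactly two chords $vv_1,vv_2$ of $S^1$ whose lines support $\triangle PQR$; with $v_1$ the one reached first moving counterclockwise from $v$, set $\psi_{\triangle PQR}(v):=v_1$ (a homeomorphism of $S^1$). $\overline{\psi_{\triangle PQR}}$ is its lift to $\mathbb{R}$ with $\overline{\psi_{\triangle PQR}}(0)\in(0,1)$, and $\rho(\psi_{\triangle PQR})=\lim_{n\to\infty}\overline{\psi_{\triangle PQR}}^{\,n}(0)/n$ is the rotation number. *)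

(* Defs.v *)
From Stdlib Require Import Reals Lra ClassicalEpsilon.
Open Scope R_scope.

Definition pt := (R * R)%type.

Definition cross (a b c : pt) : R :=
  (fst b - fst a) * (snd c - snd a) - (snd b - snd a) * (fst c - fst a).

Definition dist (a b : pt) : R :=
  sqrt ((fst a - fst b) ^ 2 + (snd a - snd b) ^ 2).

Definition in_D (a : pt) : Prop := fst a ^ 2 + snd a ^ 2 < 1.
Definition on_S1 (a : pt) : Prop := fst a ^ 2 + snd a ^ 2 = 1.

Definition circ (t : R) : pt := (cos (2 * PI * t), sin (2 * PI * t)).

Definition piS1 (x : R) : R := x - IZR (Int_part x).

Definition chord_through (P Q v1 v2 : pt) : Prop :=
  on_S1 v1 /\ on_S1 v2 /\ v1 <> v2 /\ cross v1 v2 P = 0 /\ cross v1 v2 Q = 0.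

Definition dprime (P Q : pt) : R :=
  epsilon (inhabits 0) (fun d => exists v1 v2, chord_through P Q v1 v2 /\
    d = / 2 * Rabs (ln ((dist v1 Q * dist v2 P) / (dist v1 P * dist v2 Q)))).

Definition Deltaprime (P Q : pt) : R :=
  ln ((exp (dprime P Q) + 1) / (exp (dprime P Q) - 1)).

Definition on_line (P Q S : pt) : Prop := cross P Q S = 0.

Definition is_delta (P Q Rv : pt) (m : R) : Prop :=
  (exists S, in_D S /\ on_line P Q S /\ dprime Rv S = m) /\
  (forall S, in_D S -> on_line P Q S -> m <= dprime Rv S).

Definition delta (P Q Rv : pt) : R := epsilon (inhabits 0) (is_delta P Q Rv).

Definition in_triangle (P Q Rv X : pt) : Prop :=
  exists a b c, 0 <= a /\ 0 <= b /\ 0 <= c /\ a + b + c = 1 /\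
    fst X = a * fst P + b * fst Q + c * fst Rv /\
    snd X = a * snd P + b * snd Q + c * snd Rv.

Definition nondegenerate (P Q Rv : pt) : Prop := cross P Q Rv <> 0.

Definition supports (P Q Rv a b : pt) : Prop :=
  a <> b /\
  (exists X, in_triangle P Q Rv X /\ cross a b X = 0) /\
  ((forall X, in_triangle P Q Rv X -> 0 <= cross a b X) \/
   (forall X, in_triangle P Q Rv X -> cross a b X <= 0)).

(* u in [0,1) represents psi(v) for v = circ t: the chord from v to circ u
   supports the triangle, and circ u is the first such endpoint reached
   moving counterclockwise from v (counterclockwise offset piS1 (u - t)) *)
Definition is_psi (P Q Rv : pt) (t u : R) : Prop :=
  0 <= u < 1 /\ piS1 (u - t) <> 0 /\ supports P Q Rv (circ t) (circ u) /\
  (forall u', 0 <= u' < 1 -> piS1 (u' - t) <> 0 ->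
     supports P Q Rv (circ t) (circ u') -> piS1 (u - t) <= piS1 (u' - t)).

(* psi_{PQR} as a map S^1 = [0,1) -> S^1 *)
Definition psi (P Q Rv : pt) (t : R) : R := epsilon (inhabits 0) (is_psi P Q Rv t).

Definition is_lift (P Q Rv : pt) (F : R -> R) : Prop :=
  continuity F /\ (forall x, piS1 (F x) = psi P Q Rv (piS1 x)) /\ 0 < F 0 < 1.

Definition psibar (P Q Rv : pt) : R -> R :=
  epsilon (inhabits (fun x : R => x)) (is_lift P Q Rv).

Definition rho (P Q Rv : pt) : R :=
  epsilon (inhabits 0)
    (fun r => Un_cv (fun n => Nat.iter n (psibar P Q Rv) 0 / INR n) r).

(* Main.v *)
Require Import Defs.
From Stdlib Require Import Reals Lra Lia ZArith Classical_Prop ClassicalEpsilon.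
From Coquelicot Require Import Coquelicot.
Open Scope R_scope.

(* The support map is covered by the pointwise minimum [F] of the lifts of the
   half-turns about [P], [Q] and [Rv], acting on the circle at infinity.  Each
   half-turn lift [f] is increasing and satisfies [f (f x) = x + 1]; from this
   alone, [F^2 x < x + 1] everywhere and [F^3 x > x + 1] somewhere, so the
   rotation number lies in [[1/3, 1/2)] and equals [1/3] exactly when
   [F^3 x = x + 1] has a solution.  Such a solution is an ideal triangle with
   [P], [Q] and [Rv] on its three sides, that is, a fixed point at infinity of
   the product of the three half-turns.  As a product of [2 x 2] matrices it has
   a real eigenvector iff
     [cross P Q Rv ^ 2 >= (1 - |P|^2) (1 - |Q|^2) (1 - |Rv|^2)],
   which in hyperbolic terms is [sinh d'(P,Q) * sinh delta >= 1]; and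
   [sinh d'(P,Q) * sinh Delta' = 1]. *)

(** * Translation numbers *)

(** Equality [F^2 x = x + 1] would make the three half-turns agree at [x], putting the three
    vertices on one chord; an orbit started at a suitable end of the line [PQ] is what makes [F^3]
    overshoot. Strict pointwise bounds weaken in the limit, so periodicity and compactness first
    turn them into uniform gaps. The delicate point in the equality case is that a fixed point of
    the matrix product records neither the winding nor the order in which [F] meets the vertices.
    The lifted product may advance by 1 or by 2, and in the second case the triangle of chords has
    to be reversed. Conversely, a closed orbit of [F] uses each vertex once but in an arbitrary
    order, which is harmless because the inequality is symmetric in the three points. *)

Definition degree_one (F : R -> R) : Prop :=
  (forall x y, x <= y -> F x <= F y) /\ (forall x, F (x + 1) = F x + 1).

Lemma iter_degree_one F n : degree_one F -> degree_one (Nat.iter n F).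
Proof.
intros [Fmon F1]; induction n as [|n [IHmon IH1]]; split; simpl; auto.
intro x; now rewrite IH1, F1.
Qed.

Lemma shift_IZR (F : R -> R) k x :
  (forall y, F (y + 1) = F y + 1) -> F (x + IZR k) = F x + IZR k.
Proof.
intro F1.
assert (Hnat : forall n y, F (y + INR n) = F y + INR n).
{ induction n as [|n IH]; intro y.
  - now rewrite !Rplus_0_r.
  - rewrite S_INR, <- Rplus_assoc, F1, IH; ring. }
destruct (Z_le_gt_dec 0 k) as [Hk | Hk].
- rewrite <- (Z2Nat.id k Hk), <- INR_IZR_INZ; apply Hnat.
- set (n := Z.to_nat (- k)).
  assert (Hn : IZR k = - INR n).
  { unfold n; rewrite INR_IZR_INZ, Z2Nat.id, opp_IZR by lia; ring. }
  rewrite Hn; generalize (Hnat n (x + - INR n)).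
  replace (x + - INR n + INR n) with x by ring; lra.
Qed.

(** Monotonicity squeezes [F x] between the values at the two integers around [x], and these are
    [F 0] plus those integers. *)
Lemma degree_one_displacement F x : degree_one F -> Rabs (F x - x - F 0) <= 1.
Proof.
intro HF; destruct (base_Int_part x) as [Hle Hgt].
destruct HF as [Fmon F1].
assert (H0 := shift_IZR F (Int_part x) 0 F1).
assert (H1 := shift_IZR F (Int_part x + 1) 0 F1).
rewrite plus_IZR in H1.
assert (L := Fmon (0 + IZR (Int_part x)) x ltac:(lra)).
assert (U := Fmon x (0 + (IZR (Int_part x) + 1)) ltac:(lra)).
apply Rabs_le; lra.
Qed.

(** Each block of [m] steps advances by [Nat.iter m F 0] up to an error of 1, and the errors of [n]
    blocks add up. *)
Lemma iter_orbit_mul F m n : degree_one F ->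
  Rabs (Nat.iter (n * m) F 0 - INR n * Nat.iter m F 0) <= INR n.
Proof.
intro HF; induction n as [|n IH].
- simpl; rewrite Rmult_0_l, Rminus_0_r, Rabs_R0; lra.
- replace (S n * m)%nat with (m + n * m)%nat by lia.
  rewrite Nat.iter_add, S_INR.
  generalize (degree_one_displacement _ (Nat.iter (n * m) F 0)
                (iter_degree_one F m HF)).
  intros H; apply Rabs_le_between in H; apply Rabs_le_between in IH.
  apply Rabs_le; lra.
Qed.

(** The point reached after [n * m] steps is read both as [n] blocks of [m] and as [m] blocks of
    [n]. The bound makes the means a Cauchy sequence. *)
Lemma iter_mean_dist F m n : degree_one F -> (0 < m)%nat -> (0 < n)%nat ->
  Rabs (Nat.iter n F 0 / INR n - Nat.iter m F 0 / INR m) <= / INR n + / INR m.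
Proof.
intros HF Hm Hn; apply lt_0_INR in Hm, Hn.
assert (H1 := iter_orbit_mul F m n HF).
assert (H2 := iter_orbit_mul F n m HF).
rewrite (Nat.mul_comm m n) in H2.
set (a := Nat.iter n F 0) in *; set (b := Nat.iter m F 0) in *.
apply Rabs_le_between in H1; apply Rabs_le_between in H2.
replace (a / INR n - b / INR m)
  with ((INR m * a - INR n * b) * (/ INR n * / INR m)) by (field; lra).
replace (/ INR n + / INR m)
  with ((INR m + INR n) * (/ INR n * / INR m)) by (field; lra).
assert (0 < / INR n * / INR m)
  by (apply Rmult_lt_0_compat; apply Rinv_0_lt_compat; assumption).
rewrite Rabs_mult, (Rabs_pos_eq (_ * / _)) by lra.
apply Rmult_le_compat_r; [lra | apply Rabs_le; lra].
Qed.

Lemma translation_number_exists F : degree_one F ->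
  exists l, Un_cv (fun n => Nat.iter n F 0 / INR n) l.
Proof.
intro HF.
destruct (Rcomplete.R_complete (fun n => Nat.iter n F 0 / INR n)) as [l Hl];
  [| now exists l].
intros eps Heps.
destruct (archimed_cor1 (eps / 2) ltac:(lra)) as [N [HN HN0]].
exists N; intros n m Hn Hm; unfold Rdist.
assert (HNR := lt_0_INR _ HN0).
assert (/ INR n <= / INR N) by (apply Rinv_le_contravar; [|apply le_INR]; auto).
assert (/ INR m <= / INR N) by (apply Rinv_le_contravar; [|apply le_INR]; auto).
generalize (iter_mean_dist F m n HF ltac:(lia) ltac:(lia)); lra.
Qed.

Lemma mean_limit_le (a : nat -> R) l k c B : (0 < k)%nat ->
  Un_cv (fun n => a n / INR n) l ->
  (forall n, a (k * n)%nat <= INR n * c + B) -> l <= c / INR k.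
Proof.
intros Hk Hl Ha.
destruct (Rle_lt_dec l (c / INR k)) as [H | H]; [exact H | exfalso].
set (eps := (l - c / INR k) / 2).
assert (Heps : 0 < eps) by (unfold eps; lra).
destruct (Hl eps Heps) as [N HN].
assert (HkR := lt_0_INR _ Hk).
(* The maximum with 0 keeps [n] positive even when [B] is negative. *)
destruct (INR_unbounded (Rmax 0 (B / eps))) as [M HM].
set (n := (N + M)%nat).
assert (HMn : Rmax 0 (B / eps) < INR n)
  by (unfold n; rewrite plus_INR; generalize (pos_INR N); lra).
assert (Hn0 : 0 < INR n) by (generalize (Rmax_l 0 (B / eps)); lra).
assert (HB : B < INR n * eps).
{ apply Rmult_lt_reg_r with (/ eps); [now apply Rinv_0_lt_compat|].
  rewrite Rmult_assoc, Rinv_r, Rmult_1_r by lra.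
  generalize (Rmax_r 0 (B / eps)); unfold Rdiv; lra. }
assert (Hk1 : 1 <= INR k) by (apply (le_INR 1); lia).
specialize (HN (k * n)%nat ltac:(unfold n; nia)).
unfold Rdist in HN; apply Rabs_lt_between in HN.
assert (Hup : a (k * n)%nat / INR (k * n) < c / INR k + eps).
{ rewrite mult_INR; apply Rmult_lt_reg_r with (INR k * INR n);
    [now apply Rmult_lt_0_compat|].
  replace (a (k * n)%nat / (INR k * INR n) * (INR k * INR n))
    with (a (k * n)%nat) by (field; lra).
  replace ((c / INR k + eps) * (INR k * INR n))
    with (INR n * c + INR k * (INR n * eps)) by (field; lra).
  assert (INR n * eps <= INR k * (INR n * eps))
    by (assert (0 < INR n * eps) by (apply Rmult_lt_0_compat; assumption); nra).
  specialize (Ha n); lra. }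
unfold eps in *; lra.
Qed.

Lemma mean_limit_ge (a : nat -> R) l k c B : (0 < k)%nat ->
  Un_cv (fun n => a n / INR n) l ->
  (forall n, INR n * c - B <= a (k * n)%nat) -> c / INR k <= l.
Proof.
intros Hk Hl Ha.
assert (H : - l <= - c / INR k); [| unfold Rdiv in *; lra].
apply (mean_limit_le (fun n => - a n) _ k _ B Hk).
- apply (Un_cv_ext (opp_seq (fun n => a n / INR n))); [| now apply CV_opp].
  intro n; unfold opp_seq, Rdiv; ring.
- intro n; specialize (Ha n); lra.
Qed.

Lemma iter_mul_le F k c : (forall x, Nat.iter k F x <= x + c) ->
  forall n, Nat.iter (k * n) F 0 <= INR n * c.
Proof.
intros H n; induction n as [|n IH].
- rewrite Nat.mul_0_r; simpl; lra.
- rewrite Nat.mul_succ_r, Nat.add_comm, Nat.iter_add, S_INR.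
  specialize (H (Nat.iter (k * n) F 0)); lra.
Qed.

Lemma iter_mul_ge F k c : (forall x, x + c <= Nat.iter k F x) ->
  forall n, INR n * c <= Nat.iter (k * n) F 0.
Proof.
intros H n; induction n as [|n IH].
- rewrite Nat.mul_0_r; simpl; lra.
- rewrite Nat.mul_succ_r, Nat.add_comm, Nat.iter_add, S_INR.
  specialize (H (Nat.iter (k * n) F 0)); lra.
Qed.

(** The orbit of [x] under the [k]-th iterate is exactly [x + n], and the orbit of 0 stays within 1
    of the same advance. *)
Lemma translation_number_periodic F k x l : degree_one F -> (0 < k)%nat ->
  Nat.iter k F x = x + 1 -> Un_cv (fun n => Nat.iter n F 0 / INR n) l ->
  l = 1 / INR k.
Proof.
intros HF Hk Hx Hl.
assert (Horb : forall n, Nat.iter (k * n) F x = x + INR n).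
{ induction n as [|n IH].
  - rewrite Nat.mul_0_r; simpl; ring.
  - rewrite Nat.mul_succ_r, Nat.iter_add, Hx,
      (proj2 (iter_degree_one F (k * n) HF)), IH, S_INR; ring. }
assert (Hb : forall n, Rabs (Nat.iter (k * n) F 0 - INR n) <= 1).
{ intro n.
  generalize (degree_one_displacement _ x (iter_degree_one F (k * n) HF)).
  rewrite Horb; intro H.
  rewrite Rabs_minus_sym; replace (INR n - Nat.iter (k * n) F 0)
    with (x + INR n - x - Nat.iter (k * n) F 0) by ring; exact H. }
apply Rle_antisym.
- apply (mean_limit_le _ _ k 1 1 Hk Hl); intro n.
  specialize (Hb n); apply Rabs_le_between in Hb; lra.
- apply (mean_limit_ge _ _ k 1 1 Hk Hl); intro n.
  specialize (Hb n); apply Rabs_le_between in Hb; lra.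
Qed.

Lemma periodic_negative_bounded_away (g : R -> R) : continuity g ->
  (forall x, g (x + 1) = g x) -> (forall x, g x < 0) ->
  exists eps, 0 < eps /\ forall x, g x <= - eps.
Proof.
intros Hc Hp Hneg.
destruct (continuity_ab_maj g 0 1 ltac:(lra) ltac:(intros; apply Hc))
  as [M [HM _]].
assert (Hint : forall k x, g (x + IZR k) = g x).
{ intros k x.
  (* Adding the identity turns the periodic [g] into a map commuting with unit translation, so that
     [shift_IZR] applies. *)
  generalize (shift_IZR (fun y => y + g y) k x
                ltac:(intro y; simpl; rewrite Hp; ring)); simpl; lra. }
exists (- g M); split; [specialize (Hneg M); lra|].
intro x; destruct (base_Int_part x).
rewrite <- (Hint (- Int_part x)%Z x), opp_IZR, Ropp_involutive.
apply HM; lra.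
Qed.

(** * Minima of three half-turn lifts *)

(** A half-turn is a fixed-point-free involution of the circle, so its lift with values in
    [(x, x + 1)] squares to the unit translation and not to the identity. *)
Record half_turn_lift (f : R -> R) : Prop := {
  htl_continuity : continuity f;
  htl_increasing : forall x y, x < y -> f x < f y;
  htl_square : forall x, f (f x) = x + 1 }.

Section HalfTurnLift.

Variable f : R -> R.
Hypothesis Hf : half_turn_lift f.

Lemma htl_le x y : x <= y -> f x <= f y.
Proof.
intros [H | ->]; [left; now apply htl_increasing | right; reflexivity].
Qed.

Lemma htl_shift x : f (x + 1) = f x + 1.
Proof. rewrite <- (htl_square f Hf x); apply (htl_square f Hf). Qed.

Lemma htl_gt x : x < f x.
Proof.
apply Rnot_le_lt; intro H.
assert (H1 := htl_le _ _ H); rewrite htl_square in H1 by exact Hf; lra.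
Qed.

End HalfTurnLift.

Definition min3 (p q r : R -> R) (x : R) : R := Rmin (p x) (Rmin (q x) (r x)).

Lemma min3_le p q r x :
  min3 p q r x <= p x /\ min3 p q r x <= q x /\ min3 p q r x <= r x.
Proof.
unfold min3; generalize (Rmin_l (p x) (Rmin (q x) (r x)))
  (Rmin_r (p x) (Rmin (q x) (r x))) (Rmin_l (q x) (r x)) (Rmin_r (q x) (r x)).
lra.
Qed.

Lemma min3_case p q r x :
  min3 p q r x = p x \/ min3 p q r x = q x \/ min3 p q r x = r x.
Proof.
unfold min3, Rmin; destruct (Rle_dec (q x) (r x)); destruct (Rle_dec (p x) _); auto.
Qed.

Lemma continuity_Rmin f g : continuity f -> continuity g ->
  continuity (fun x => Rmin (f x) (g x)).
Proof.
intros Hf Hg x.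
apply continuity_pt_ext with
  (fun y => (f y + g y - Rabs (f y - g y)) * / 2).
{ intro y; unfold Rmin; destruct (Rle_dec (f y) (g y));
    [rewrite Rabs_left1 by lra | rewrite Rabs_pos_eq by lra]; field. }
apply (continuity_pt_mult (fun y => f y + g y - Rabs (f y - g y))
         (fun _ => / 2)); [| apply continuity_pt_const; now intros ? ?].
apply continuity_pt_minus; [now apply continuity_pt_plus|].
apply (continuity_pt_comp (fun y => f y - g y)); [now apply continuity_pt_minus|].
apply Rcontinuity_abs.
Qed.

Lemma min3_continuity p q r : continuity p -> continuity q -> continuity r ->
  continuity (min3 p q r).
Proof. intros; now repeat apply continuity_Rmin. Qed.

Lemma continuity_iter (F : R -> R) n : continuity F -> continuity (Nat.iter n F).
Proof.
intro HF; induction n as [|n IH]; intro x.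
- apply derivable_continuous_pt, derivable_pt_id.
- apply (continuity_pt_comp (Nat.iter n F)); [apply IH | apply HF].
Qed.

Lemma continuity_zero_between g x y : continuity g -> g x < 0 -> 0 < g y ->
  exists z, g z = 0.
Proof.
intros Hg Hx Hy.
destruct (Rtotal_order x y) as [Hxy | [-> | Hxy]].
- destruct (IVT g x y Hg Hxy Hx Hy) as [z [_ Hz]]; now exists z.
- lra.
- destruct (IVT (- g)%F y x (continuity_opp g Hg) Hxy) as [z [_ Hz]];
    unfold opp_fct in *; [lra | lra | exists z; lra].
Qed.

Lemma htl_meet p q : half_turn_lift p -> half_turn_lift q -> exists x, p x = q x.
Proof.
intros Hp Hq.
(* If [p > q] everywhere, then [x + 1 = p (p x) > q (q x) = x + 1]. *)
assert (Hnever : forall f g, half_turn_lift f -> half_turn_lift g ->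
          ~ forall x, f x < g x).
{ intros f g Hf Hg H.
  assert (H1 := H (f 0)); rewrite (htl_square _ Hf) in H1.
  assert (H2 := htl_increasing _ Hg _ _ (H 0)); rewrite (htl_square _ Hg) in H2.
  lra. }
apply NNPP; intro Hne.
assert (Hdiff : forall x, p x <> q x) by (intros x E; apply Hne; now exists x).
assert (Hc : continuity (fun x => p x - q x))
  by (apply continuity_minus; [apply Hp | apply Hq]).
destruct (Rtotal_order (p 0) (q 0)) as [H0 | [H0 | H0]];
  [| now apply (Hdiff 0) |].
- apply (Hnever p q Hp Hq); intro x; apply Rnot_le_lt; intro Hx.
  destruct (continuity_zero_between _ 0 x Hc) as [z Hz]; [lra | | ].
  + generalize (Hdiff x); lra.
  + apply (Hdiff z); lra.
- apply (Hnever q p Hq Hp); intro x; apply Rnot_le_lt; intro Hx.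
  destruct (continuity_zero_between _ x 0 Hc) as [z Hz]; [| lra |].
  + generalize (Hdiff x); lra.
  + apply (Hdiff z); lra.
Qed.

Section MinOfThree.

Variables p q r : R -> R.
Hypothesis Hp : half_turn_lift p.
Hypothesis Hq : half_turn_lift q.
Hypothesis Hr : half_turn_lift r.

Let F := min3 p q r.

Lemma min3_increasing x y : x < y -> F x < F y.
Proof.
intro H; destruct (min3_le p q r x) as (h1 & h2 & h3).
assert (H1 := htl_increasing _ Hp _ _ H).
assert (H2 := htl_increasing _ Hq _ _ H).
assert (H3 := htl_increasing _ Hr _ _ H).
unfold F; destruct (min3_case p q r y) as [E | [E | E]]; rewrite E; lra.
Qed.

Lemma min3_degree_one : degree_one F.
Proof.
split.
- intros x y [H | ->]; [left; now apply min3_increasing | right; reflexivity].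
- intro x; unfold F, min3; rewrite !htl_shift by assumption.
  now rewrite <- !Rplus_min_distr_r.
Qed.

Hypothesis Hnoncoll : forall x, ~ (p x = q x /\ q x = r x).

(** For each of the three maps [f], [F (F x) <= f (F x) <= f (f x) = x + 1]. Equality of the ends
    forces [f x = F x] for all three at once. *)
Lemma min3_iter2_lt x : F (F x) < x + 1.
Proof.
destruct (min3_le p q r x) as (h1 & h2 & h3).
destruct (min3_le p q r (F x)) as (k1 & k2 & k3).
fold F in h1, h2, h3, k1, k2, k3.
apply Rnot_le_lt; intro H; apply (Hnoncoll x).
assert (Hge : forall f, half_turn_lift f -> F x <= f x -> F (F x) <= f (F x) ->
          f x = F x).
{ intros f Hf h k; apply Rle_antisym; [| exact h].
  apply Rnot_lt_le; intro Hlt.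
  apply (htl_increasing _ Hf) in Hlt; rewrite (htl_square _ Hf) in Hlt; lra. }
rewrite (Hge p), (Hge q), (Hge r) by assumption; auto.
Qed.

(** Start at an end [x] of the line through the first two centres with the third on the far side, so
    that [F x = p x] is the other end [y]. From [y] the third map gives the minimum [z], short of
    [x + 1]; from [z > y] all three maps pass [x + 1]. *)
Lemma min3_iter3_gt_somewhere : exists x, x + 1 < F (F (F x)).
Proof.
assert (Hx : exists x, p x = q x /\ p x < r x).
{ destruct (htl_meet p q Hp Hq) as [x E].
  destruct (Rtotal_order (p x) (r x)) as [H | [H | H]].
  - now exists x.
  - exfalso; apply (Hnoncoll x); lra.
  (* The third centre is on the wrong side seen from [x]; the opposite end of the same line
     exchanges the sides. *)
  - exists (p x); split.
    + rewrite (htl_square _ Hp), E, (htl_square _ Hq); reflexivity.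
    + rewrite (htl_square _ Hp), <- (htl_square _ Hr).
      now apply (htl_increasing _ Hr). }
destruct Hx as [x [E Hrx]]; exists x.
assert (F1 : F x = p x).
{ unfold F, min3; rewrite <- E, (Rmin_left (p x) (r x)) by lra.
  now rewrite Rmin_left by lra. }
set (y := p x) in *.
assert (Hpy : p y = x + 1) by apply (htl_square _ Hp).
assert (Hqy : q y = x + 1) by (rewrite E; apply (htl_square _ Hq)).
assert (Hry : r y < x + 1).
{ rewrite <- (htl_square _ Hr); now apply (htl_increasing _ Hr). }
assert (F2 : F y = r y).
{ unfold F, min3; rewrite Hpy, Hqy, Rmin_right; rewrite Rmin_right; lra. }
rewrite F1, F2; set (z := r y).
assert (Hyz : y < z) by now apply htl_gt.
assert (Hxy : x < y) by now apply htl_gt.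
unfold F, min3; repeat apply Rmin_glb_lt.
- rewrite <- Hpy; now apply (htl_increasing _ Hp).
- rewrite <- Hqy; now apply (htl_increasing _ Hq).
- unfold z; rewrite (htl_square _ Hr); lra.
Qed.

Lemma min3_iter3_gt : (forall x, F (F (F x)) <> x + 1) ->
  forall x, x + 1 < F (F (F x)).
Proof.
intros Hne x; destruct min3_iter3_gt_somewhere as [y Hy].
apply Rnot_le_lt; intro Hx.
assert (HF : continuity F) by (apply min3_continuity; [apply Hp | apply Hq | apply Hr]).
destruct (continuity_zero_between (fun x => Nat.iter 3 F x - (x + 1)) x y)
  as [z Hz].
- apply continuity_minus; [now apply continuity_iter|].
  apply continuity_plus; [apply derivable_continuous, derivable_id|].
  apply continuity_const; now intros ? ?.
- simpl; generalize (Hne x); lra.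
- simpl; lra.
- apply (Hne z); simpl in Hz; lra.
Qed.

(** Two consecutive steps by the same half-turn would advance by exactly 1, against [min3_iter2_lt].
    The orbit is closed, so the last and first steps are consecutive too. *)
Lemma min3_cycle_distinct x : F (F (F x)) = x + 1 ->
  exists f g h, f (x) = F x /\ g (F x) = F (F x) /\ h (F (F x)) = x + 1 /\
    (f = p \/ f = q \/ f = r) /\ (g = p \/ g = q \/ g = r) /\
    (h = p \/ h = q \/ h = r) /\ f <> g /\ g <> h /\ h <> f.
Proof.
intro E.
assert (Hpick : forall y, exists f, f y = F y /\ (f = p \/ f = q \/ f = r)).
{ intro y; destruct (min3_case p q r y) as [H | [H | H]];
    [exists p | exists q | exists r]; auto. }
assert (Hh : forall f, f = p \/ f = q \/ f = r -> half_turn_lift f)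
  by (intros f [-> | [-> | ->]]; assumption).
destruct (Hpick x) as [f [Ef Hf]].
destruct (Hpick (F x)) as [g [Eg Hg]].
destruct (Hpick (F (F x))) as [h [Eh Hh']].
exists f, g, h; rewrite <- E; repeat split; auto.
- intro Hfg; generalize (min3_iter2_lt x).
  rewrite <- Eg, <- Hfg, <- Ef, (htl_square _ (Hh _ Hf)); lra.
- intro Hgh; generalize (min3_iter2_lt (F x)).
  rewrite <- Eh, <- Hgh, <- Eg, (htl_square _ (Hh _ Hg)); lra.
- intro Hhf; generalize (min3_iter2_lt (F (F x))).
  rewrite E, (proj2 min3_degree_one); rewrite <- Hhf in Ef.
  assert (H := htl_square h (Hh _ Hh') (F (F x))).
  rewrite Eh, E, (htl_shift h (Hh _ Hh')) in H; lra.
Qed.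

End MinOfThree.

Lemma min3_swap12 p q r x : min3 p q r x = min3 q p r x.
Proof. unfold min3; now rewrite !Rmin_assoc, (Rmin_comm (p x)). Qed.

Lemma min3_rotate p q r x : min3 p q r x = min3 q r p x.
Proof. unfold min3; now rewrite Rmin_comm, Rmin_assoc. Qed.

(* The chords of a closed triangle met in counterclockwise order support it. *)
Lemma min3_cycle_step p q r x : half_turn_lift p -> half_turn_lift q ->
  half_turn_lift r -> r (q (p x)) = x + 1 -> min3 p q r x = p x.
Proof.
intros Hp Hq Hr E.
(* Applying [r] to the closing relation gives [r x = q (p x)], the chord of the last side run
   backwards. *)
assert (Hrx : p x < r x).
{ apply Rlt_le_trans with (q (p x)); [now apply htl_gt|].
  apply Req_le, Rplus_eq_reg_r with 1.
  now rewrite <- (htl_shift r Hr), <- E, (htl_square _ Hr). }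
(* Otherwise [q (p x)] is already at least [x + 1], and [r] would move strictly beyond it. *)
assert (Hqx : p x < q x).
{ apply Rnot_le_lt; intro H; apply (htl_le q Hq) in H.
  rewrite (htl_square _ Hq), <- E in H.
  generalize (htl_gt r Hr (q (p x))); lra. }
unfold min3; rewrite Rmin_left; [reflexivity|].
apply Rmin_glb; lra.
Qed.

(** The closing relation at [x] yields the cyclically rotated one at [p x] and at [q (p x)], so
    [min3_cycle_step] serves all three steps. *)
Lemma min3_cycle p q r x : half_turn_lift p -> half_turn_lift q ->
  half_turn_lift r -> r (q (p x)) = x + 1 ->
  min3 p q r (min3 p q r (min3 p q r x)) = x + 1.
Proof.
intros Hp Hq Hr E.
rewrite (min3_cycle_step p q r x) by assumption.
rewrite (min3_rotate p q r (p x)), (min3_cycle_step q r p (p x)); try assumption;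
  [| rewrite E; now apply htl_shift].
rewrite (min3_rotate p q r), (min3_rotate q r p).
rewrite (min3_cycle_step r p q (q (p x))); try assumption.
rewrite E, (htl_shift p Hp); now apply htl_shift.
Qed.

(* A chord triangle closing up after two turns is run through clockwise;
   reversing it gives one that closes up after one turn. *)
Lemma min3_cycle_or_reverse p q r x : half_turn_lift p -> half_turn_lift q ->
  half_turn_lift r -> r (q (p x)) = x + 1 \/ r (q (p x)) = x + 2 ->
  exists y, min3 p q r (min3 p q r (min3 p q r y)) = y + 1.
Proof.
intros Hp Hq Hr [E | E]; exists x; [now apply min3_cycle|].
(* Each lift is its own inverse up to a unit translation, so the advances of the forward and
   reversed products sum to 3; here the forward one is 2. *)
assert (Hrev : p (q (r x)) = x + 1).
{ assert (Erx : r x = q (p x) - 1).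
  { assert (r (r (q (p x))) = r (x + 1 + 1)) by (f_equal; lra).
    rewrite (htl_square _ Hr), !(htl_shift r Hr) in H; lra. }
  assert (Eqx : q (r x) = p x).
  { rewrite Erx.
    assert (H := htl_shift q Hq (q (p x) - 1)).
    replace (q (p x) - 1 + 1) with (q (p x)) in H by ring.
    rewrite (htl_square _ Hq) in H; lra. }
  rewrite Eqx; apply (htl_square _ Hp). }
assert (Hext : forall y, min3 p q r y = min3 r q p y).
{ intro y; now rewrite min3_rotate, min3_swap12. }
rewrite !Hext; now apply min3_cycle.
Qed.

Theorem translation_number_min3 p q r :
  half_turn_lift p -> half_turn_lift q -> half_turn_lift r ->
  (forall x, ~ (p x = q x /\ q x = r x)) ->
  exists l, Un_cv (fun n => Nat.iter n (min3 p q r) 0 / INR n) l /\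
    ((exists x, min3 p q r (min3 p q r (min3 p q r x)) = x + 1) -> l = 1 / 3) /\
    ((forall x, min3 p q r (min3 p q r (min3 p q r x)) <> x + 1) ->
     1 / 3 < l < 1 / 2).
Proof.
intros Hp Hq Hr Hnc; set (F := min3 p q r).
assert (HF : degree_one F) by now apply min3_degree_one.
assert (HFc : continuity F)
  by (apply min3_continuity; [apply Hp | apply Hq | apply Hr]).
destruct (translation_number_exists F HF) as [l Hl].
exists l; split; [exact Hl | split].
- intros [x Hx].
  rewrite (translation_number_periodic F 3 x l HF ltac:(lia) Hx Hl); simpl; lra.
- intro Hne.
  assert (Hcont : forall k, continuity (fun x => Nat.iter k F x - (x + 1))).
  { intro k; apply continuity_minus; [now apply continuity_iter|].
    apply continuity_plus; [apply derivable_continuous, derivable_id|].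
    apply continuity_const; now intros ? ?. }
  assert (Hper : forall k x, Nat.iter k F (x + 1) - (x + 1 + 1)
                             = Nat.iter k F x - (x + 1)).
  { intros k x; rewrite (proj2 (iter_degree_one F k HF)); ring. }
  split.
  (* The displacement is periodic, so the strict inequality has a uniform gap [eps], and the bound
     becomes [(1 + eps) / 3]. *)
  + destruct (periodic_negative_bounded_away (fun x => - (Nat.iter 3 F x - (x + 1))))
      as [eps [Heps Hb]].
    * apply continuity_opp, Hcont.
    * intro x; now rewrite Hper.
    * intro x; assert (H : x + 1 < F (F (F x)))
        by exact (min3_iter3_gt p q r Hp Hq Hr Hnc Hne x).
      simpl; lra.
    * assert (H := mean_limit_ge _ l 3 (1 + eps) 0 ltac:(lia) Hl).
      assert (Hge := iter_mul_ge F 3 (1 + eps)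
                 ltac:(intro x; specialize (Hb x); lra)).
      simpl INR in H; enough ((1 + eps) / (1 + 1 + 1) <= l) by lra.
      apply H; intro n; specialize (Hge n); lra.
  + destruct (periodic_negative_bounded_away (fun x => Nat.iter 2 F x - (x + 1)))
      as [eps [Heps Hb]].
    * apply Hcont.
    * intro x; now rewrite Hper.
    * intro x; assert (H : F (F x) < x + 1)
        by exact (min3_iter2_lt p q r Hp Hq Hr Hnc x).
      simpl; lra.
    * assert (H := mean_limit_le _ l 2 (1 - eps) 0 ltac:(lia) Hl).
      assert (Hle := iter_mul_le F 2 (1 - eps)
                 ltac:(intro x; specialize (Hb x); lra)).
      simpl INR in H; enough (l <= (1 - eps) / (1 + 1)) by lra.
      apply H; intro n; specialize (Hle n); lra.
Qed.

(** * Half-turns acting on the circle *)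

(* The Minkowski form on the homogeneous vectors [(X, 1)]. *)
Definition mink (X Y : pt) : R := 1 - fst X * fst Y - snd X * snd Y.

Lemma mink_diag_pos X : in_D X -> 0 < mink X X.
Proof. unfold in_D, mink; lra. Qed.

(* Coordinates of [X - circ t] along the counterclockwise tangent and the
   inner normal at [circ t]. *)
Definition tangential (X : pt) (t : R) : R :=
  snd X * cos (2 * PI * t) - fst X * sin (2 * PI * t).
Definition depth (X : pt) (t : R) : R :=
  1 - fst X * cos (2 * PI * t) - snd X * sin (2 * PI * t).

(* By the inscribed angle theorem the chord from [circ t] through [X] ends at
   [circ (half_turn X t)]. *)
Definition half_turn (X : pt) (t : R) : R :=
  t + 1 / 2 - atan (tangential X t / depth X t) / PI.

Lemma sin2_cos2_pow x : sin x ^ 2 + cos x ^ 2 = 1.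
Proof. rewrite <- (sin2_cos2 x); unfold Rsqr; ring. Qed.

(** Cauchy-Schwarz for [X] and the unit vector [circ t], through Lagrange's identity. *)
Lemma depth_pos X t : in_D X -> 0 < depth X t.
Proof.
unfold in_D, depth; intro HX.
generalize (sin2_cos2_pow (2 * PI * t)).
set (c := cos _); set (s := sin _); intro E.
set (x := fst X) in *; set (y := snd X) in *.
assert ((x * c + y * s) ^ 2 + (x * s - y * c) ^ 2 = x ^ 2 + y ^ 2)
  by (transitivity ((x ^ 2 + y ^ 2) * (s ^ 2 + c ^ 2)); [ring | rewrite E; ring]).
generalize (pow2_ge_0 (x * s - y * c)); intro H1.
assert (H2 : (x * c + y * s) ^ 2 < 1) by lra; nra.
Qed.

(** Both sides are the squared distance from [X] to [circ t]. *)
Lemma tangential_depth_sqr X t :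
  tangential X t ^ 2 + depth X t ^ 2 = 2 * depth X t - mink X X.
Proof.
unfold tangential, depth, mink; generalize (sin2_cos2_pow (2 * PI * t)).
set (c := cos _); set (s := sin _); intro E.
transitivity ((fst X ^ 2 + snd X ^ 2) * (s ^ 2 + c ^ 2) + 1
              - 2 * fst X * c - 2 * snd X * s); [ring | rewrite E; ring].
Qed.

(* The derivative is the Poisson kernel. *)
Lemma half_turn_derive X t : in_D X ->
  is_derive (half_turn X) t
    (mink X X / (tangential X t ^ 2 + depth X t ^ 2)).
Proof.
intro HX; assert (Hd := depth_pos X t HX); assert (HPI := PI_RGT_0).
assert (Es := tangential_depth_sqr X t).
unfold half_turn; unfold tangential, depth in *.
auto_derive; [lra|].
generalize Hd Es; set (c := cos _); set (s := sin _); clear Hd Es; intros Hd Es.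
set (a := snd X * c - fst X * s) in *.
assert (Eb : fst X * c + snd X * s = 1 - (1 - fst X * c - snd X * s)) by ring.
set (b := 1 - fst X * c - snd X * s) in *.
assert (Hab : 0 < a ^ 2 + b ^ 2) by nra.
replace (mink X X) with (2 * b - (a ^ 2 + b ^ 2)) by lra.
replace (1 + - (fst X * c) + - (snd X * s)) with b by (unfold b; ring).
replace (snd X * c + - (fst X * s)) with a by (unfold a; ring).
replace (snd X * (2 * PI * 1 * - s) + - (fst X * (2 * PI * 1 * c)))
  with (- (2 * PI) * (1 - b)) by (rewrite <- Eb; ring).
replace (- (fst X * (2 * PI * 1 * - s)) + - (snd X * (2 * PI * 1 * c)))
  with (- (2 * PI) * a) by (unfold a; ring).
clearbody a b; field; repeat split; nra.
Qed.

Lemma half_turn_bounds X t : t < half_turn X t < t + 1.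
Proof.
unfold half_turn; assert (HPI := PI_RGT_0).
generalize (atan_bound (tangential X t / depth X t)); set (u := atan _); intros Hu.
assert (Ha : - (1 / 2) < u / PI < 1 / 2); [| lra].
split; apply Rmult_lt_reg_r with PI; try lra;
  replace (u / PI * PI) with u by (field; lra); lra.
Qed.

(** Homogeneous coordinates of [circ t] on the projective line: with the half-angle, adding 1 to [t]
    only changes the sign. *)
Definition ray (t : R) : R * R := (cos (PI * t), sin (PI * t)).

Definition scale (k : R) (q : R * R) : R * R := (k * fst q, k * snd q).

(** It vanishes exactly on proportional pairs; hence [wedge q (M q) = 0] for [q] nonzero says that
    [q] is an eigenvector of [M]. *)
Definition wedge (q q' : R * R) : R := fst q * snd q' - snd q * fst q'.

(* In the rational parametrization of the circle by half-angles, the half-turn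
   about [X] is the traceless matrix [[-y, x + 1], [x - 1, y]]. *)
Definition act (X : pt) (q : R * R) : R * R :=
  ((fst X + 1) * snd q - snd X * fst q, (fst X - 1) * fst q + snd X * snd q).

Lemma act_scale X k q : act X (scale k q) = scale k (act X q).
Proof. unfold act, scale; simpl; f_equal; ring. Qed.

(** Cayley-Hamilton for a traceless matrix: its square is minus its determinant, which is
    [mink X X]. *)
Lemma act_act X q : act X (act X q) = scale (- mink X X) q.
Proof. destruct q; unfold act, scale, mink; simpl; f_equal; ring. Qed.

Lemma scale_scale k l q : scale k (scale l q) = scale (k * l) q.
Proof. unfold scale; simpl; f_equal; ring. Qed.

Lemma wedge_scale_r k q q' : wedge q (scale k q') = k * wedge q q'.
Proof. unfold wedge, scale; simpl; ring. Qed.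

Lemma wedge_diag q : wedge q q = 0.
Proof. unfold wedge; ring. Qed.

Lemma wedge_ray t u : wedge (ray t) (ray u) = sin (PI * (u - t)).
Proof. unfold wedge, ray; simpl; rewrite Rmult_minus_distr_l, sin_minus; ring. Qed.

(** Trades the arctangent for an angle [u] with polynomial relations between its sine and cosine. *)
Lemma half_turn_angle X t : in_D X ->
  exists u, 0 < cos u /\ depth X t * sin u = tangential X t * cos u /\
    PI * half_turn X t = PI / 2 + (PI * t - u).
Proof.
intro HX; assert (Hb := depth_pos X t HX); assert (HPI := PI_RGT_0).
set (u := atan (tangential X t / depth X t)); exists u.
assert (Hc : 0 < cos u).
{ generalize (atan_bound (tangential X t / depth X t)); intro.
  apply cos_gt_0; unfold u; lra. }
split; [exact Hc | split; [| unfold half_turn; fold u; field; lra]].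
assert (H : tan u = tangential X t / depth X t) by apply tan_atan.
unfold tan in H; apply Rmult_eq_reg_r with (/ (cos u * depth X t));
  [| apply Rinv_neq_0_compat; nra].
replace (depth X t * sin u * / (cos u * depth X t)) with (sin u / cos u)
  by (field; lra).
rewrite H; field; lra.
Qed.

Lemma act_ray X t : in_D X ->
  exists k, k <> 0 /\ act X (ray t) = scale k (ray (half_turn X t)).
Proof.
intro HX; assert (Hb := depth_pos X t HX).
destruct (half_turn_angle X t HX) as (u & Hc & Hs & Hu).
exists (- (depth X t / cos u)); split.
- apply Ropp_neq_0_compat; apply Rgt_not_eq, Rdiv_lt_0_compat; assumption.
- unfold scale, ray; simpl; rewrite Hu.
  rewrite <- cos_sin, cos_plus, cos_PI2, sin_PI2, sin_minus, cos_minus.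
  assert (Hcs := sin2_cos2_pow (PI * t)).
  assert (Ha : tangential X t = snd X * (cos (PI * t) ^ 2 - sin (PI * t) ^ 2)
            - fst X * (2 * sin (PI * t) * cos (PI * t))).
  { unfold tangential; replace (2 * PI * t) with (2 * (PI * t)) by ring.
    rewrite cos_2a, sin_2a; ring. }
  assert (Hd : depth X t = 1 - fst X * (cos (PI * t) ^ 2 - sin (PI * t) ^ 2)
            - snd X * (2 * sin (PI * t) * cos (PI * t))).
  { unfold depth; replace (2 * PI * t) with (2 * (PI * t)) by ring.
    rewrite cos_2a, sin_2a; ring. }
  unfold act; simpl; set (c := cos (PI * t)) in *; set (s := sin (PI * t)) in *.
  f_equal.
  + transitivity (depth X t * s - tangential X t * c).
    * rewrite Ha, Hd; transitivity (s + (fst X * s - snd X * c) * (s ^ 2 + c ^ 2));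
        [rewrite Hcs; ring | ring].
    * apply Rmult_eq_reg_r with (cos u); [| lra].
      transitivity (depth X t * s * cos u - c * (depth X t * sin u));
        [rewrite Hs; ring | field; lra].
  + transitivity (- (depth X t * c + tangential X t * s)).
    * rewrite Ha, Hd; transitivity (- c + (fst X * c + snd X * s) * (s ^ 2 + c ^ 2));
        [rewrite Hcs; ring | ring].
    * apply Rmult_eq_reg_r with (cos u); [| lra].
      transitivity (- (depth X t * c * cos u + s * (depth X t * sin u)));
        [rewrite Hs; ring | field; lra].
Qed.

Lemma sin_PI_mul_eq_0 z : sin (PI * z) = 0 -> exists k : Z, z = IZR k.
Proof.
intro H; destruct (sin_eq_0_0 _ H) as [k Hk]; exists k.
apply Rmult_eq_reg_l with PI; [lra | apply PI_neq0].
Qed.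

(** The squared matrix is scalar, so the total advance is an integer; the bounds on each half-turn
    place it strictly between 0 and 2. *)
Lemma half_turn_square X t : in_D X -> half_turn X (half_turn X t) = t + 1.
Proof.
intro HX; destruct (act_ray X t HX) as [k [Hk E1]].
destruct (act_ray X (half_turn X t) HX) as [l [Hl E2]].
assert (E : wedge (ray t) (act X (act X (ray t))) = 0)
  by (rewrite act_act, wedge_scale_r, wedge_diag; ring).
rewrite E1, act_scale, E2, scale_scale, wedge_scale_r, wedge_ray in E.
apply Rmult_integral in E as [E | E].
{ apply Rmult_integral in E; tauto. }
destruct (sin_PI_mul_eq_0 _ E) as [n Hn].
generalize (half_turn_bounds X t) (half_turn_bounds X (half_turn X t)); intros.
assert (0 < n < 2)%Z by (split; apply lt_IZR; lra).
replace n with 1%Z in Hn by lia; lra.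
Qed.

Lemma half_turn_is_lift X : in_D X -> half_turn_lift (half_turn X).
Proof.
intro HX; split.
- intro t; apply derivable_continuous_pt; eexists.
  now apply is_derive_Reals, half_turn_derive.
- intros x y Hxy.
  apply (incr_function (half_turn X) m_infty p_infty
           (fun t => mink X X
                     / (tangential X t ^ 2 + depth X t ^ 2))); simpl; auto.
  + intros; now apply half_turn_derive.
  + intros t _ _; apply Rdiv_lt_0_compat; [now apply mink_diag_pos|].
    assert (Hd := depth_pos X t HX); simpl; nra.
- intro t; now apply half_turn_square.
Qed.

Lemma quadratic_form_isotropic a b c :
  (exists s t, (s <> 0 \/ t <> 0) /\ a * s ^ 2 + b * s * t + c * t ^ 2 = 0) <->
  4 * (a * c) <= b ^ 2.
Proof.
split.
- intros (s & t & [Hs | Ht] & E).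
  + assert ((b ^ 2 - 4 * (a * c)) * s ^ 2 = (2 * c * t + b * s) ^ 2
              - 4 * c * (a * s ^ 2 + b * s * t + c * t ^ 2)) by ring.
    assert (0 < s ^ 2) by (apply pow2_gt_0; exact Hs).
    generalize (pow2_ge_0 (2 * c * t + b * s)); rewrite E in H; nra.
  + assert ((b ^ 2 - 4 * (a * c)) * t ^ 2 = (2 * a * s + b * t) ^ 2
              - 4 * a * (a * s ^ 2 + b * s * t + c * t ^ 2)) by ring.
    assert (0 < t ^ 2) by (apply pow2_gt_0; exact Ht).
    generalize (pow2_ge_0 (2 * a * s + b * t)); rewrite E in H; nra.
- intro H; destruct (Req_dec a 0) as [-> | Ha].
  + exists 1, 0; split; [left; lra | ring].
  + exists ((- b + sqrt (b ^ 2 - 4 * (a * c))) / (2 * a)), 1.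
    split; [right; lra|].
    set (d := sqrt _); assert (Hd : d ^ 2 = b ^ 2 - 4 * (a * c))
      by (apply pow2_sqrt; lra).
    transitivity ((d ^ 2 - (b ^ 2 - 4 * (a * c))) / (4 * a)); [field; lra|].
    rewrite Hd; field; lra.
Qed.

(* The isotropic vectors of this form are the real eigenvectors of the product
   of the three half-turn matrices, whose trace is [2 * cross P Q Rv] up to sign
   and whose determinant is the product on the left. *)
Lemma half_turns_eigenvector P Q Rv :
  (exists q, (fst q <> 0 \/ snd q <> 0) /\
             wedge q (act Rv (act Q (act P q))) = 0) <->
  mink P P * mink Q Q
    * mink Rv Rv <= cross P Q Rv ^ 2.
Proof.
set (w := fun q => wedge q (act Rv (act Q (act P q)))).
(* The coefficients of the quadratic form are recovered from its values at three vectors. *)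
set (a := w (1, 0)); set (c := w (0, 1)); set (b := w (1, 1) - a - c).
assert (Hw : forall s t, w (s, t) = a * s ^ 2 + b * s * t + c * t ^ 2)
  by (intros; unfold b, a, c, w, wedge, act; simpl; ring).
assert (Hdisc : b ^ 2 - 4 * (a * c) = 4 * (cross P Q Rv ^ 2
  - mink P P * mink Q Q
    * mink Rv Rv))
  by (unfold b, a, c, w, wedge, act, cross, mink; simpl; ring).
assert (Hiff := quadratic_form_isotropic a b c).
split.
- intros [[s t] [Hq E]]; change (w (s, t) = 0) in E; rewrite Hw in E.
  enough (4 * (a * c) <= b ^ 2) by lra.
  apply Hiff; now exists s, t.
- intro H; destruct (proj2 Hiff ltac:(lra)) as (s & t & Hq & E).
  exists (s, t); split; [exact Hq | now rewrite <- Hw in E].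
Qed.

Lemma on_S1_polar x y : x ^ 2 + y ^ 2 = 1 -> exists u, x = cos u /\ y = sin u.
Proof.
intro E; assert (Hx : -1 <= x <= 1) by nra.
assert (Hy : sin (acos x) = Rabs y).
{ rewrite sin_acos by exact Hx; rewrite <- sqrt_Rsqr_abs; f_equal.
  unfold Rsqr; lra. }
destruct (Rle_lt_dec 0 y) as [H | H].
- exists (acos x); rewrite cos_acos by exact Hx.
  now rewrite Hy, Rabs_pos_eq.
- exists (- acos x); rewrite cos_neg, cos_acos, sin_neg by exact Hx.
  rewrite Hy, Rabs_left by exact H; lra.
Qed.

Lemma ray_exists q : fst q <> 0 \/ snd q <> 0 ->
  exists k t, k <> 0 /\ q = scale k (ray t).
Proof.
destruct q as [s t]; simpl; intro Hq.
assert (Hn : 0 < s ^ 2 + t ^ 2)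
  by (destruct Hq as [H | H]; apply pow2_gt_0 in H;
      generalize (pow2_ge_0 s) (pow2_ge_0 t); lra).
set (n := sqrt (s ^ 2 + t ^ 2)).
assert (Hn0 : 0 < n) by now apply sqrt_lt_R0.
assert (Hn2 : n ^ 2 = s ^ 2 + t ^ 2) by (apply pow2_sqrt; lra).
destruct (on_S1_polar (s / n) (t / n)) as [u [Es Et]].
{ transitivity ((s ^ 2 + t ^ 2) / n ^ 2); [field; lra|].
  rewrite <- Hn2; field; lra. }
exists n, (u / PI); split; [lra|].
unfold scale, ray; simpl.
replace (PI * (u / PI)) with u by (field; apply PI_neq0).
rewrite <- Es, <- Et; f_equal; field; lra.
Qed.

(** An eigenvector is a multiple of some [ray t], which the product returns to the same point of the
    circle. Three advances strictly between 0 and 1 sum to an integer, hence to 1 or 2. *)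
Lemma half_turns_close_up P Q Rv : in_D P -> in_D Q -> in_D Rv ->
  (exists t, half_turn Rv (half_turn Q (half_turn P t)) = t + 1 \/
             half_turn Rv (half_turn Q (half_turn P t)) = t + 2) <->
  mink P P * mink Q Q
    * mink Rv Rv <= cross P Q Rv ^ 2.
Proof.
intros HP HQ HR; rewrite <- half_turns_eigenvector.
assert (Hw : forall t, exists k, k <> 0 /\
  wedge (ray t) (act Rv (act Q (act P (ray t))))
  = k * sin (PI * (half_turn Rv (half_turn Q (half_turn P t)) - t))).
{ intro t; destruct (act_ray P t HP) as (k1 & H1 & E1).
  destruct (act_ray Q (half_turn P t) HQ) as (k2 & H2 & E2).
  destruct (act_ray Rv (half_turn Q (half_turn P t)) HR) as (k3 & H3 & E3).
  exists (k1 * k2 * k3); split.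
  - repeat apply Rmult_integral_contrapositive_currified; assumption.
  - rewrite E1, act_scale, E2, !act_scale, E3, !wedge_scale_r, wedge_ray; ring. }
split.
- intros [t Ht]; exists (ray t); split.
  + unfold ray; simpl; destruct (Req_dec (cos (PI * t)) 0) as [E | E]; [right | now left].
    intro E'; generalize (sin2_cos2_pow (PI * t)); rewrite E, E'; lra.
  + destruct (Hw t) as (k & _ & ->).
    assert (Hs : sin (PI * (half_turn Rv (half_turn Q (half_turn P t)) - t)) = 0).
    { apply sin_eq_0_1; destruct Ht as [-> | ->];
        [exists 1%Z | exists 2%Z]; ring. }
    rewrite Hs; ring.
- intros [q [Hq E]]; destruct (ray_exists q Hq) as (k & t & Hk & ->).
  rewrite !act_scale, wedge_scale_r in E.
  assert (E' : wedge (ray t) (act Rv (act Q (act P (ray t)))) = 0).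
  { apply Rmult_eq_reg_l with (k * k);
      [| now apply Rmult_integral_contrapositive_currified].
    rewrite Rmult_0_r, <- E; unfold wedge, scale; simpl; ring. }
  destruct (Hw t) as (l & Hl & El); rewrite El in E'.
  apply Rmult_integral in E' as [E' | E']; [easy|].
  destruct (sin_PI_mul_eq_0 _ E') as [n Hn].
  generalize (half_turn_bounds P t) (half_turn_bounds Q (half_turn P t))
    (half_turn_bounds Rv (half_turn Q (half_turn P t))); intros.
  assert (0 < n < 3)%Z by (split; apply lt_IZR; lra).
  exists t; assert (n = 1 \/ n = 2)%Z as [-> | ->] by lia; [left | right]; lra.
Qed.

(** Equal images mean equal slopes seen from [circ t], so all three points would lie on one
    chord. *)
Lemma half_turns_noncollinear P Q Rv t : in_D P -> in_D Q -> in_D Rv ->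
  nondegenerate P Q Rv ->
  ~ (half_turn P t = half_turn Q t /\ half_turn Q t = half_turn Rv t).
Proof.
intros HP HQ HR Hnd [E1 E2]; apply Hnd.
assert (Hslope : forall X Y, half_turn X t = half_turn Y t ->
  tangential X t / depth X t = tangential Y t / depth Y t).
{ intros X Y E; unfold half_turn in E.
  rewrite <- (tan_atan (tangential X t / _)), <- (tan_atan (tangential Y t / _)).
  f_equal; apply Rmult_eq_reg_r with (/ PI);
    [lra | apply Rinv_neq_0_compat, PI_neq0]. }
apply Hslope in E1; apply Hslope in E2.
set (g := tangential Q t / depth Q t) in *.
assert (Hline : forall X, in_D X -> tangential X t / depth X t = g ->
   (g * cos (2 * PI * t) - sin (2 * PI * t)) * fst X
   + (g * sin (2 * PI * t) + cos (2 * PI * t)) * snd X = g).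
{ intros X HX E; assert (Hd := depth_pos X t HX).
  assert (E' : tangential X t = g * depth X t) by (rewrite <- E; field; lra).
  unfold tangential, depth in E'; lra. }
assert (LP := Hline P HP E1); assert (LQ := Hline Q HQ eq_refl).
assert (LR := Hline Rv HR (eq_sym E2)).
assert (Hcs := sin2_cos2_pow (2 * PI * t)).
set (c := cos _) in *; set (s := sin _) in *.
clearbody g c s; unfold cross.
set (m := g * c - s) in *; set (n := g * s + c) in *.
assert (Hmn : 0 < m ^ 2 + n ^ 2).
{ replace (m ^ 2 + n ^ 2) with ((g ^ 2 + 1) * (s ^ 2 + c ^ 2))
    by (unfold m, n; ring).
  rewrite Hcs; generalize (pow2_ge_0 g); lra. }
apply Rmult_eq_reg_l with (m ^ 2 + n ^ 2); [| lra].
assert (D1 : m * (fst Q - fst P) + n * (snd Q - snd P) = 0) by lra.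
assert (D2 : m * (fst Rv - fst P) + n * (snd Rv - snd P) = 0) by lra.
(* Both edge vectors are orthogonal to the nonzero [(m, n)], so their determinant vanishes. *)
transitivity
  (m * ((m * (fst Q - fst P) + n * (snd Q - snd P)) * (snd Rv - snd P)
        - (m * (fst Rv - fst P) + n * (snd Rv - snd P)) * (snd Q - snd P))
   + n * ((m * (fst Rv - fst P) + n * (snd Rv - snd P)) * (fst Q - fst P)
          - (m * (fst Q - fst P) + n * (snd Q - snd P)) * (fst Rv - fst P)));
  [ring | rewrite D1, D2; ring].
Qed.

(** * The support map and its lift *)

(** The chord has length [2 * sin (PI * s)] and makes the angle [PI * s] with the tangent at
    [circ t]; the other factor is the signed distance of [X] from it. *)
Lemma cross_circ X t s : cross (circ t) (circ (t + s)) X =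
  2 * sin (PI * s) * (cos (PI * s) * depth X t - sin (PI * s) * tangential X t).
Proof.
unfold cross, circ, depth, tangential; simpl.
replace (2 * PI * (t + s)) with (2 * PI * t + 2 * (PI * s)) by ring.
rewrite cos_plus, sin_plus, cos_2a, sin_2a.
generalize (sin2_cos2_pow (2 * PI * t)) (sin2_cos2_pow (PI * s)).
set (c := cos (2 * PI * t)); set (d := sin (2 * PI * t)).
set (a := cos (PI * s)); set (b := sin (PI * s)); intros E E'.
replace (a * a - b * b) with (1 - 2 * b ^ 2) by (rewrite <- E'; ring).
transitivity (2 * b * (a * (d ^ 2 + c ^ 2 - fst X * c - snd X * d)
   - b * (snd X * c - fst X * d))); [ring | rewrite E; ring].
Qed.

Lemma cross_circ_half_turn X t s : in_D X -> 0 < s < 1 ->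
  exists k, 0 < k /\
    cross (circ t) (circ (t + s)) X = k * sin (PI * (half_turn X t - (t + s))).
Proof.
intros HX Hs; assert (Hb := depth_pos X t HX); assert (HPI := PI_RGT_0).
destruct (half_turn_angle X t HX) as (u & Hc & Hu & E).
assert (Hsin : 0 < sin (PI * s)) by (apply sin_gt_0; nra).
exists (2 * sin (PI * s) * (depth X t / cos u)); split.
- apply Rmult_lt_0_compat; [lra | now apply Rdiv_lt_0_compat].
- replace (PI * (half_turn X t - (t + s))) with (PI / 2 + - (PI * s + u))
    by (rewrite Rmult_minus_distr_l, E; ring).
  rewrite <- cos_sin, cos_neg, cos_plus, cross_circ.
  apply Rmult_eq_reg_r with (cos u); [| lra].
  transitivity (2 * sin (PI * s) * (cos (PI * s) * depth X t * cos u
     - sin (PI * s) * (depth X t * sin u))); [rewrite Hu; ring | field; lra].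
Qed.

Lemma cross_circ_pos X t s : in_D X -> 0 < s < 1 -> t + s < half_turn X t ->
  0 < cross (circ t) (circ (t + s)) X.
Proof.
intros HX Hs H; destruct (cross_circ_half_turn X t s HX Hs) as (k & Hk & ->).
assert (HPI := PI_RGT_0); generalize (half_turn_bounds X t); intro.
apply Rmult_lt_0_compat; [exact Hk | apply sin_gt_0; nra].
Qed.

Lemma cross_circ_eq0 X t s : in_D X -> 0 < s < 1 -> t + s = half_turn X t ->
  cross (circ t) (circ (t + s)) X = 0.
Proof.
intros HX Hs H; destruct (cross_circ_half_turn X t s HX Hs) as (k & Hk & ->).
rewrite H, Rminus_diag, Rmult_0_r, sin_0; ring.
Qed.

Lemma circ_neq t s : 0 < s < 1 -> circ t <> circ (t + s).
Proof.
intros Hs E; assert (HPI := PI_RGT_0).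
assert (Hsin : 0 < sin (PI * s)) by (apply sin_gt_0; nra).
injection E as Ec Es.
assert (Hc : cos (2 * (PI * s)) = 1).
{ replace (2 * (PI * s)) with (2 * PI * (t + s) - 2 * PI * t) by ring.
  rewrite cos_minus, <- Ec, <- Es, <- (sin2_cos2_pow (2 * PI * t)); ring. }
rewrite cos_2a_sin in Hc; nra.
Qed.

Lemma circ_IZR t k : circ (t + IZR k) = circ t.
Proof.
unfold circ.
assert (E : 2 * PI * (t + IZR k) = 2 * PI * t + 2 * IZR k * PI) by ring.
f_equal; rewrite E; destruct (Z_le_gt_dec 0 k) as [Hk | Hk].
- rewrite <- (Z2Nat.id k Hk), <- INR_IZR_INZ; apply cos_period.
- rewrite <- (cos_period _ (Z.to_nat (- k))), INR_IZR_INZ, Z2Nat.id, opp_IZR by lia.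
  f_equal; ring.
- rewrite <- (Z2Nat.id k Hk), <- INR_IZR_INZ; apply sin_period.
- rewrite <- (sin_period _ (Z.to_nat (- k))), INR_IZR_INZ, Z2Nat.id, opp_IZR by lia.
  f_equal; ring.
Qed.

Lemma piS1_bounds x : 0 <= piS1 x < 1.
Proof. unfold piS1; destruct (base_Int_part x); lra. Qed.

Lemma piS1_shift x : exists k, x = piS1 x + IZR k.
Proof. exists (Int_part x); unfold piS1; ring. Qed.

Lemma piS1_unique x y k : 0 <= y < 1 -> x = y + IZR k -> piS1 x = y.
Proof.
intros Hy ->; unfold piS1.
rewrite <- (Int_part_spec (y + IZR k) k) by lra; ring.
Qed.

Lemma in_triangle_vertices P Q Rv :
  in_triangle P Q Rv P /\ in_triangle P Q Rv Q /\ in_triangle P Q Rv Rv.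
Proof.
split; [| split]; [exists 1, 0, 0 | exists 0, 1, 0 | exists 0, 0, 1];
  repeat split; lra.
Qed.

Lemma cross_in_triangle P Q Rv X a b : in_triangle P Q Rv X ->
  exists u v w, 0 <= u /\ 0 <= v /\ 0 <= w /\ u + v + w = 1 /\
    cross a b X = u * cross a b P + v * cross a b Q + w * cross a b Rv.
Proof.
intros (u & v & w & Hu & Hv & Hw & E & Ex & Ey); exists u, v, w.
repeat split; try assumption.
unfold cross; rewrite Ex, Ey; replace w with (1 - u - v) by lra; ring.
Qed.

Section SupportMap.

Variables P Q Rv : pt.
Hypothesis HP : in_D P.
Hypothesis HQ : in_D Q.
Hypothesis HR : in_D Rv.

Let F := min3 (half_turn P) (half_turn Q) (half_turn Rv).

Lemma min3_half_turn_bounds t : t < F t < t + 1.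
Proof.
unfold F; destruct (min3_case (half_turn P) (half_turn Q) (half_turn Rv) t)
  as [-> | [-> | ->]]; apply half_turn_bounds.
Qed.

(** A chord ending before [F t] has the three vertices, hence the whole triangle, strictly on its
    left, and cannot touch it. *)
Lemma supports_ge t s : 0 < s < 1 -> supports P Q Rv (circ t) (circ (t + s)) ->
  F t <= t + s.
Proof.
intros Hs (_ & (X & HX & E) & _); apply Rnot_lt_le; intro H.
destruct (min3_le (half_turn P) (half_turn Q) (half_turn Rv) t) as (h1 & h2 & h3).
fold F in h1, h2, h3.
assert (CP := cross_circ_pos P t s HP Hs ltac:(lra)).
assert (CQ := cross_circ_pos Q t s HQ Hs ltac:(lra)).
assert (CR := cross_circ_pos Rv t s HR Hs ltac:(lra)).
destruct (cross_in_triangle P Q Rv X (circ t) (circ (t + s)) HX)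
  as (u & v & w & Hu & Hv & Hw & Esum & EX).
rewrite E in EX.
assert (0 <= u * cross (circ t) (circ (t + s)) P) by (apply Rmult_le_pos; lra).
assert (0 <= v * cross (circ t) (circ (t + s)) Q) by (apply Rmult_le_pos; lra).
assert (0 <= w * cross (circ t) (circ (t + s)) Rv) by (apply Rmult_le_pos; lra).
assert (u = 0) by nra; assert (v = 0) by nra; assert (w = 0) by nra; lra.
Qed.

(** At [F t] the minimizing vertex lies on the chord and the other two are on it or to its left. *)
Lemma supports_min3 t : supports P Q Rv (circ t) (circ (F t)).
Proof.
set (s := F t - t).
assert (Hb := min3_half_turn_bounds t).
assert (Hs : 0 < s < 1) by (unfold s; lra).
replace (F t) with (t + s) by (unfold s; ring).
assert (HE : t + s = F t) by (unfold s; ring).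
destruct (min3_le (half_turn P) (half_turn Q) (half_turn Rv) t) as (h1 & h2 & h3).
fold F in h1, h2, h3; rewrite <- HE in h1, h2, h3.
assert (Hnn : forall X, in_D X -> t + s <= half_turn X t ->
          0 <= cross (circ t) (circ (t + s)) X).
{ intros X HX [H | H]; [left; now apply cross_circ_pos|].
  right; symmetry; now apply cross_circ_eq0. }
split; [now apply circ_neq | split; [| left]].
- destruct (in_triangle_vertices P Q Rv) as (VP & VQ & VR).
  destruct (min3_case (half_turn P) (half_turn Q) (half_turn Rv) t) as [E | [E | E]];
    fold F in E; rewrite <- HE in E;
    [exists P | exists Q | exists Rv]; split; auto; now apply cross_circ_eq0.
- intros X HX.
  destruct (cross_in_triangle P Q Rv X (circ t) (circ (t + s)) HX)
    as (u & v & w & Hu & Hv & Hw & _ & ->).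
  repeat apply Rplus_le_le_0_compat; apply Rmult_le_pos; auto.
Qed.

Lemma piS1_offset u t : 0 <= u < 1 -> piS1 (u - t) <> 0 ->
  0 < piS1 (u - t) < 1 /\ circ (t + piS1 (u - t)) = circ u.
Proof.
intros Hu H; destruct (piS1_bounds (u - t)); split; [lra|].
destruct (piS1_shift (u - t)) as [k Hk].
rewrite <- (circ_IZR _ k); f_equal; lra.
Qed.

Lemma piS1_min3_offset t : piS1 (piS1 (F t) - t) = F t - t.
Proof.
assert (Hb := min3_half_turn_bounds t).
destruct (piS1_shift (F t)) as [k Hk].
apply (piS1_unique _ _ (- k)); [lra|]; rewrite opp_IZR; lra.
Qed.

Lemma is_psi_min3 t : is_psi P Q Rv t (piS1 (F t)).
Proof.
assert (Hb := min3_half_turn_bounds t).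
split; [apply piS1_bounds|]; rewrite piS1_min3_offset.
split; [lra | split].
- destruct (piS1_shift (F t)) as [k Hk].
  rewrite <- (circ_IZR (piS1 (F t)) k), <- Hk; apply supports_min3.
- intros u Hu Hu0 Hsup.
  destruct (piS1_offset u t Hu Hu0) as [Hs E]; rewrite <- E in Hsup.
  assert (H := supports_ge t _ Hs Hsup); lra.
Qed.

Lemma psi_min3 t : psi P Q Rv t = piS1 (F t).
Proof.
assert (H0 := is_psi_min3 t).
assert (H : is_psi P Q Rv t (psi P Q Rv t))
  by (apply (epsilon_spec (inhabits 0) (is_psi P Q Rv t)); now exists (piS1 (F t))).
set (u := psi P Q Rv t) in *; set (v := piS1 (F t)) in *.
destruct H as (Hu & Hu0 & Hus & Hum), H0 as (Hv & Hv0 & Hvs & Hvm).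
assert (E : piS1 (u - t) = piS1 (v - t)) by (apply Rle_antisym; auto).
destruct (piS1_shift (u - t)) as [k Hk], (piS1_shift (v - t)) as [l Hl].
assert (Ekl : u - v = IZR (k - l)) by (rewrite minus_IZR; lra).
assert (-1 < k - l < 1)%Z by (split; apply lt_IZR; lra).
replace (k - l)%Z with 0%Z in Ekl by lia; lra.
Qed.

Lemma min3_half_turn_IZR k t : F (t + IZR k) = F t + IZR k.
Proof.
apply shift_IZR, min3_degree_one; now apply half_turn_is_lift.
Qed.

Lemma is_lift_min3 : is_lift P Q Rv F.
Proof.
split; [| split].
- apply min3_continuity; now apply half_turn_is_lift.
- intro x; rewrite psi_min3.
  destruct (piS1_shift x) as [k Hk], (piS1_shift (F x)) as [l Hl].
  symmetry; apply (piS1_unique _ _ (l - k)); [apply piS1_bounds|].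
  rewrite minus_IZR; assert (H := min3_half_turn_IZR k (piS1 x)).
  rewrite <- Hk in H; lra.
- generalize (min3_half_turn_bounds 0); lra.
Qed.

(** Two lifts differ by a continuous integer-valued function. It is 0 at 0, where both values lie in
    [(0, 1)], and cannot cross a half-integer elsewhere. *)
Lemma psibar_min3 x : psibar P Q Rv x = F x.
Proof.
assert (H : is_lift P Q Rv (psibar P Q Rv))
  by (apply (epsilon_spec (inhabits (fun y : R => y)) (is_lift P Q Rv));
      exists F; apply is_lift_min3).
set (G := psibar P Q Rv) in *.
destruct H as (Gc & Gpi & G0), is_lift_min3 as (Fc & Fpi & F0).
assert (Hint : forall y, exists k, G y - F y = IZR k).
{ intro y; assert (E : piS1 (G y) = piS1 (F y)) by now rewrite Gpi, Fpi.
  destruct (piS1_shift (G y)) as [k Hk], (piS1_shift (F y)) as [l Hl].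
  exists (k - l)%Z; rewrite minus_IZR; lra. }
assert (Hzero : G 0 - F 0 = 0).
{ destruct (Hint 0) as [k Hk]; rewrite Hk.
  assert (-1 < k < 1)%Z by (split; apply lt_IZR; lra).
  now replace k with 0%Z by lia. }
assert (Hhalf : forall y c, 0 < c < 1 -> G y - F y <> c /\ G y - F y <> - c).
{ intros y c Hc; destruct (Hint y) as [k ->]; split; intro E.
  - assert (0 < k < 1)%Z by (split; apply lt_IZR; lra); lia.
  - assert (-1 < k < 0)%Z by (split; apply lt_IZR; lra); lia. }
destruct (Rtotal_order (G x - F x) 0) as [H | [H | H]]; [exfalso | lra | exfalso].
- destruct (Hint x) as [k Hk]; assert (k <= -1)%Z.
  { assert (k < 0)%Z by (apply lt_IZR; lra); lia. }
  assert (IZR k <= -1) by now apply IZR_le.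
  destruct (continuity_zero_between (fun y => G y - F y + 1 / 2) x 0) as [z Hz];
    [| lra | lra | apply (proj2 (Hhalf z (1 / 2) ltac:(lra))); lra].
  apply continuity_plus; [now apply continuity_minus|].
  apply continuity_const; now intros ? ?.
- destruct (Hint x) as [k Hk]; assert (1 <= k)%Z.
  { assert (0 < k)%Z by (apply lt_IZR; lra); lia. }
  assert (1 <= IZR k) by now apply IZR_le.
  destruct (continuity_zero_between (fun y => G y - F y - 1 / 2) 0 x) as [z Hz];
    [| lra | lra | apply (proj1 (Hhalf z (1 / 2) ltac:(lra))); lra].
  apply continuity_minus; [now apply continuity_minus|].
  apply continuity_const; now intros ? ?.
Qed.

End SupportMap.

Lemma rho_criterion P Q Rv : in_D P -> in_D Q -> in_D Rv -> nondegenerate P Q Rv ->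
  (mink P P * mink Q Q
    * mink Rv Rv <= cross P Q Rv ^ 2 -> rho P Q Rv = 1 / 3) /\
  (cross P Q Rv ^ 2 < mink P P * mink Q Q
    * mink Rv Rv -> 1 / 3 < rho P Q Rv < 1 / 2).
Proof.
intros HP HQ HR Hnd.
set (p := half_turn P); set (q := half_turn Q); set (r := half_turn Rv).
assert (Lp : half_turn_lift p) by now apply half_turn_is_lift.
assert (Lq : half_turn_lift q) by now apply half_turn_is_lift.
assert (Lr : half_turn_lift r) by now apply half_turn_is_lift.
assert (Hnc : forall x, ~ (p x = q x /\ q x = r x))
  by (intro x; now apply half_turns_noncollinear).
destruct (translation_number_min3 p q r Lp Lq Lr Hnc) as (l & Hl & Hl1 & Hl2).
assert (Hcv : Un_cv (fun n => Nat.iter n (psibar P Q Rv) 0 / INR n) l).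
{ apply (Un_cv_ext (fun n => Nat.iter n (min3 p q r) 0 / INR n)); [| exact Hl].
  intro n; f_equal; induction n as [|n IH]; [reflexivity|]; simpl.
  now rewrite IH, psibar_min3. }
assert (Hrho : rho P Q Rv = l).
{ apply (UL_sequence (fun n => Nat.iter n (psibar P Q Rv) 0 / INR n));
    [| exact Hcv].
  apply (epsilon_spec (inhabits 0)
    (fun r => Un_cv (fun n => Nat.iter n (psibar P Q Rv) 0 / INR n) r)).
  now exists l. }
rewrite Hrho; split; intro H.
- apply Hl1.
  apply (half_turns_close_up P Q Rv HP HQ HR) in H as [x Hx].
  now apply (min3_cycle_or_reverse p q r x).
- apply Hl2; intros x Hx.
  destruct (min3_cycle_distinct p q r Lp Lq Lr Hnc x Hx)
    as (f & g & h & Ef & Eg & Eh & Hf & Hg & Hh & Dfg & Dgh & Dhf).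
  assert (E : h (g (f x)) = x + 1) by (rewrite Ef, Eg; exact Eh).
  apply (Rlt_not_le _ _ H).
  destruct Hf as [-> | [-> | ->]], Hg as [-> | [-> | ->]], Hh as [-> | [-> | ->]];
    try congruence; unfold p, q, r in E.
  (* Six orders of the vertices remain; permuting them changes [cross] by at most a sign, so each
     gives the same contradiction. *)
  all: match type of E with half_turn ?Z (half_turn ?Y (half_turn ?X _)) = _ =>
    assert (Hle := proj1 (half_turns_close_up X Y Z ltac:(assumption)
      ltac:(assumption) ltac:(assumption)) (ex_intro _ x (or_introl E)))
  end.
  all: unfold cross in *; lra.
Qed.

(** * Hyperbolic distances in the Klein model *)

Local Notation dist := Defs.dist.

Lemma sinh_half_abs_ln_sqr r : 0 < r ->
  sinh (/ 2 * Rabs (ln r)) ^ 2 = (r - 1) ^ 2 / (4 * r).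
Proof.
intro Hr; set (y := / 2 * ln r).
assert (Habs : sinh (/ 2 * Rabs (ln r)) ^ 2 = sinh y ^ 2).
{ unfold y, Rabs; destruct (Rcase_abs (ln r)); [| reflexivity].
  unfold sinh; replace (- (/ 2 * - ln r)) with (/ 2 * ln r) by ring.
  replace (/ 2 * - ln r) with (- (/ 2 * ln r)) by ring; field. }
assert (Hy : exp y ^ 2 = r).
{ rewrite <- (exp_ln r Hr) at 1; simpl; rewrite Rmult_1_r, <- exp_plus.
  f_equal; unfold y; field. }
rewrite Habs; unfold sinh; rewrite exp_Ropp.
assert (He := exp_pos y).
rewrite <- Hy; field; lra.
Qed.

Lemma sinh_pos x : 0 < x -> 0 < sinh x.
Proof. intro H; rewrite <- sinh_0; now apply sinh_lt. Qed.

Lemma sinh_nonneg x : 0 <= x -> 0 <= sinh x.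
Proof.
intros [H | <-]; [left; now apply sinh_pos | rewrite sinh_0; lra].
Qed.

Lemma sinh_sqr_lt x y : 0 <= x -> 0 <= y -> sinh x ^ 2 < sinh y ^ 2 <-> x < y.
Proof.
intros Hx Hy; apply sinh_nonneg in Hx as Sx; apply sinh_nonneg in Hy as Sy.
split; intro H.
- apply Rnot_le_lt; intros [L | ->]; [apply sinh_lt in L; nra | lra].
- apply sinh_lt in H; nra.
Qed.

Lemma sqr_dist_pos (X Y : pt) : X <> Y ->
  0 < (fst Y - fst X) ^ 2 + (snd Y - snd X) ^ 2.
Proof.
destruct X as [a b], Y as [c d]; simpl fst; simpl snd; intro Hne.
generalize (pow2_ge_0 (c - a)) (pow2_ge_0 (d - b)); intros.
destruct (Req_dec c a) as [-> | Hca].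
- assert (Hdb : d - b <> 0) by (intro; apply Hne; f_equal; lra).
  apply pow2_gt_0 in Hdb; lra.
- assert (Hca' : c - a <> 0) by lra; apply pow2_gt_0 in Hca'; lra.
Qed.

Lemma chord_point v1 v2 X : on_S1 v1 -> on_S1 v2 -> v1 <> v2 ->
  cross v1 v2 X = 0 -> in_D X ->
  exists p, 0 < p < 1 /\ fst X = fst v1 + p * (fst v2 - fst v1) /\
    snd X = snd v1 + p * (snd v2 - snd v1).
Proof.
destruct v1 as [a b], v2 as [c d], X as [x y].
unfold on_S1, cross, in_D; simpl fst; simpl snd; intros H1 H2 Hne Hc HX.
set (L := (c - a) ^ 2 + (d - b) ^ 2).
assert (HL : 0 < L) by exact (sqr_dist_pos _ _ Hne).
set (p := ((x - a) * (c - a) + (y - b) * (d - b)) / L).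
assert (Ex : x = a + p * (c - a)).
{ apply Rmult_eq_reg_r with L; [| lra].
  transitivity (a * L + ((x - a) * (c - a) + (y - b) * (d - b)) * (c - a)
     - (d - b) * ((c - a) * (y - b) - (d - b) * (x - a)));
    [unfold L; ring | rewrite Hc; unfold p; field; lra]. }
assert (Ey : y = b + p * (d - b)).
{ apply Rmult_eq_reg_r with L; [| lra].
  transitivity (b * L + ((x - a) * (c - a) + (y - b) * (d - b)) * (d - b)
     + (c - a) * ((c - a) * (y - b) - (d - b) * (x - a)));
    [unfold L; ring | rewrite Hc; unfold p; field; lra]. }
exists p; split; [| now split].
(* Power of the point [X]: the product of its distances to the chord's ends is [1 - |X|^2]. *)
assert (Hp : 0 < p * (1 - p) * L).
{ replace (p * (1 - p) * L) with (1 - (x ^ 2 + y ^ 2)); [lra|].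
  rewrite Ex, Ey; unfold L.
  transitivity (1 - ((1 - p) * (a ^ 2 + b ^ 2) + p * (c ^ 2 + d ^ 2))
    + p * (1 - p) * ((c - a) ^ 2 + (d - b) ^ 2)); [ring | rewrite H1, H2; ring]. }
clearbody p L; assert (0 < p * (1 - p)) by nra; nra.
Qed.

Lemma chord_exists P Q : in_D P -> P <> Q -> exists v1 v2, chord_through P Q v1 v2.
Proof.
destruct P as [a b], Q as [c d]; unfold in_D; simpl fst; simpl snd; intros HP Hne.
set (L := (c - a) ^ 2 + (d - b) ^ 2).
assert (HL : 0 < L) by exact (sqr_dist_pos _ _ Hne).
(* The chord ends are the points [P + tau * (Q - P)] with [L * tau^2 + 2 * m * tau - (1 - |P|^2) =
   0]; below, [e] is the sign of the root. *)
set (m := a * (c - a) + b * (d - b)).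
assert (Hdisc : 0 < m ^ 2 + L * (1 - (a ^ 2 + b ^ 2)))
  by (generalize (pow2_ge_0 m); nra).
set (z := sqrt (m ^ 2 + L * (1 - (a ^ 2 + b ^ 2)))).
assert (Hz : 0 < z) by now apply sqrt_lt_R0.
assert (Hz2 : z ^ 2 = m ^ 2 + L * (1 - (a ^ 2 + b ^ 2))) by (apply pow2_sqrt; lra).
assert (Hon : forall e, e ^ 2 = 1 -> on_S1 (a + (- m + e * z) / L * (c - a),
                                 b + (- m + e * z) / L * (d - b))).
{ intros e He; unfold on_S1; simpl fst; simpl snd.
  transitivity (a ^ 2 + b ^ 2 + (e ^ 2 * z ^ 2 - m ^ 2) / L).
  - set (tau := (- m + e * z) / L).
    assert (Et : tau * L = - m + e * z) by (unfold tau; field; lra).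
    transitivity (a ^ 2 + b ^ 2 + 2 * tau * m + tau * (tau * L));
      [unfold m, L; ring|].
    rewrite Et; unfold tau; field; lra.
  - rewrite He, Hz2; field; lra. }
exists (a + (- m + 1 * z) / L * (c - a), b + (- m + 1 * z) / L * (d - b)).
exists (a + (- m + -1 * z) / L * (c - a), b + (- m + -1 * z) / L * (d - b)).
split; [apply Hon; ring | split; [apply Hon; ring | split; [| split]]];
  [| unfold cross; simpl; ring | unfold cross; simpl; ring].
intro E; injection E as E1 E2.
assert (Hdz : (- m + 1 * z) / L - (- m + -1 * z) / L = 2 * z / L) by (field; lra).
assert (Hpos : 0 < 2 * z / L) by (apply Rdiv_lt_0_compat; lra).
set (t1 := (- m + 1 * z) / L) in *; set (t2 := (- m + -1 * z) / L) in *.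
assert (c - a = 0) by (apply Rmult_eq_reg_l with (t1 - t2); lra).
assert (d - b = 0) by (apply Rmult_eq_reg_l with (t1 - t2); lra).
apply Hne; f_equal; lra.
Qed.

Lemma dist_scaled v1 v2 X Y k : 0 <= k ->
  fst X - fst Y = k * (fst v2 - fst v1) -> snd X - snd Y = k * (snd v2 - snd v1) ->
  dist X Y = k * dist v2 v1.
Proof.
intros Hk Ex Ey; unfold dist; rewrite Ex, Ey.
rewrite !Rpow_mult_distr, <- Rmult_plus_distr_l.
rewrite sqrt_mult_alt by apply pow2_ge_0; now rewrite sqrt_pow2.
Qed.

(** This is the Minkowski formula for [cosh d'] cleared of denominators. The chord ends are
    isotropic for [mink], so all pairings of [P] and [Q] reduce to multiples of [mink v1 v2]. *)
Lemma dprime_sinh P Q : in_D P -> in_D Q -> P <> Q ->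
  0 < dprime P Q /\
  mink P P * mink Q Q * sinh (dprime P Q) ^ 2 = mink P Q ^ 2 - mink P P * mink Q Q.
Proof.
intros HP HQ Hne.
assert (Hex : exists d, exists v1 v2, chord_through P Q v1 v2 /\
  d = / 2 * Rabs (ln ((dist v1 Q * dist v2 P) / (dist v1 P * dist v2 Q)))).
{ destruct (chord_exists P Q HP Hne) as (v1 & v2 & H); eauto. }
assert (Hd := epsilon_spec (inhabits 0) _ Hex); fold (dprime P Q) in Hd.
destruct Hd as (v1 & v2 & (S1 & S2 & Hv & CP & CQ) & Ed).
destruct (chord_point v1 v2 P S1 S2 Hv CP HP) as (p & Hp & Px & Py).
destruct (chord_point v1 v2 Q S1 S2 Hv CQ HQ) as (q & Hq & Qx & Qy).
assert (Hpq : p <> q).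
{ intros ->; apply Hne; destruct P, Q; simpl in *; congruence. }
assert (HL : 0 < dist v2 v1) by (apply sqrt_lt_R0; exact (sqr_dist_pos _ _ Hv)).
assert (HL2 : dist v2 v1 ^ 2 = 2 * mink v1 v2).
{ unfold dist; rewrite pow2_sqrt
    by (generalize (pow2_ge_0 (fst v2 - fst v1)) (pow2_ge_0 (snd v2 - snd v1)); lra).
  unfold on_S1 in *; unfold mink; lra. }
assert (dist_comm : forall X Y, dist X Y = dist Y X)
  by (intros; unfold dist; f_equal; ring).
assert (D1 : dist v1 Q = q * dist v2 v1)
  by (rewrite dist_comm; apply dist_scaled; lra).
assert (D2 : dist v1 P = p * dist v2 v1)
  by (rewrite dist_comm; apply dist_scaled; lra).
assert (D3 : dist v2 P = (1 - p) * dist v2 v1) by (apply dist_scaled; lra).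
assert (D4 : dist v2 Q = (1 - q) * dist v2 v1) by (apply dist_scaled; lra).
set (r := q * (1 - p) / (p * (1 - q))).
assert (Er : dist v1 Q * dist v2 P / (dist v1 P * dist v2 Q) = r)
  by (rewrite D1, D2, D3, D4; unfold r; field; lra).
rewrite Er in Ed.
assert (Hr : 0 < r) by (apply Rdiv_lt_0_compat; nra).
assert (Hsq : sinh (dprime P Q) ^ 2
              = (q - p) ^ 2 / (4 * (p * (1 - p) * (q * (1 - q))))).
{ rewrite Ed, sinh_half_abs_ln_sqr by exact Hr; unfold r; field; lra. }
assert (Hself : forall X, on_S1 X -> mink X X = 0) by (unfold on_S1, mink; intros; lra).
assert (MP : mink P P = 2 * (p * (1 - p)) * mink v1 v2).
{ transitivity ((1 - p) ^ 2 * mink v1 v1 + 2 * (p * (1 - p)) * mink v1 v2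
      + p ^ 2 * mink v2 v2); [unfold mink; rewrite Px, Py; ring|].
  rewrite !Hself by assumption; ring. }
assert (MQ : mink Q Q = 2 * (q * (1 - q)) * mink v1 v2).
{ transitivity ((1 - q) ^ 2 * mink v1 v1 + 2 * (q * (1 - q)) * mink v1 v2
      + q ^ 2 * mink v2 v2); [unfold mink; rewrite Qx, Qy; ring|].
  rewrite !Hself by assumption; ring. }
assert (MPQ : mink P Q = (p * (1 - q) + q * (1 - p)) * mink v1 v2).
{ transitivity ((1 - p) * (1 - q) * mink v1 v1
      + (p * (1 - q) + q * (1 - p)) * mink v1 v2 + p * q * mink v2 v2);
    [unfold mink; rewrite Px, Py, Qx, Qy; ring|].
  rewrite !Hself by assumption; ring. }
split.
- assert (Hge : 0 <= dprime P Q) by (rewrite Ed; generalize (Rabs_pos (ln r)); lra).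
  destruct Hge as [H | H]; [exact H | exfalso].
  rewrite <- H, sinh_0 in Hsq.
  assert (0 < (q - p) ^ 2 / (4 * (p * (1 - p) * (q * (1 - q))))); [| lra].
  apply Rdiv_lt_0_compat; [apply pow2_gt_0; lra|].
  assert (0 < p * (1 - p)) by nra; assert (0 < q * (1 - q)) by nra; nra.
- rewrite Hsq, MP, MQ, MPQ; field; lra.
Qed.

(** [Deltaprime] is the logarithm of [coth (d' / 2)], and [(coth - tanh) / 2] at [d' / 2] equals
    [1 / sinh d']. *)
Lemma Deltaprime_sinh P Q : in_D P -> in_D Q -> P <> Q ->
  0 < Deltaprime P Q /\ sinh (Deltaprime P Q) * sinh (dprime P Q) = 1.
Proof.
intros HP HQ Hne; destruct (dprime_sinh P Q HP HQ Hne) as [Hd _].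
unfold Deltaprime; set (d := dprime P Q) in *.
assert (He : 1 < exp d) by (rewrite <- exp_0; now apply exp_increasing).
assert (Hz : 1 < (exp d + 1) / (exp d - 1)).
{ apply Rmult_lt_reg_r with (exp d - 1); [lra|].
  replace ((exp d + 1) / (exp d - 1) * (exp d - 1)) with (exp d + 1)
    by (field; lra); lra. }
split; [rewrite <- ln_1; apply ln_increasing; lra|].
unfold sinh; rewrite !exp_Ropp, exp_ln by lra.
field; nra.
Qed.

(** Cauchy-Schwarz, with [Y] allowed on the boundary: the foot of the perpendicular is first known
    only to lie in the closed disk. *)
Lemma mink_pos X Y : in_D X -> 0 <= mink Y Y -> 0 < mink X Y.
Proof.
destruct X as [a b], Y as [c d]; unfold in_D, mink; simpl; intros HX HY.
assert (E : (a * c + b * d) ^ 2 + (a * d - b * c) ^ 2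
            = (a ^ 2 + b ^ 2) * (c ^ 2 + d ^ 2)) by ring.
generalize (pow2_ge_0 (a * d - b * c)) (pow2_ge_0 a) (pow2_ge_0 b)
  (pow2_ge_0 c) (pow2_ge_0 d); intros.
assert ((a * c + b * d) ^ 2 < 1) by nra; nra.
Qed.

Lemma line_param P Q S : P <> Q -> on_line P Q S ->
  exists s, fst S = fst P + s * (fst Q - fst P) /\
            snd S = snd P + s * (snd Q - snd P).
Proof.
destruct P as [a b], Q as [c d], S as [x y]; unfold on_line, cross;
  simpl fst; simpl snd; intros Hne E.
destruct (Req_dec c a) as [-> | Hca].
- destruct (Req_dec d b) as [-> | Hdb]; [now contradict Hne|].
  exists ((y - b) / (d - b)); split; [| field; lra].
  assert ((d - b) * (x - a) = 0) by lra.
  apply Rmult_integral in H as [H | H]; lra.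
- exists ((x - a) / (c - a)); split; [field; lra|].
  apply Rmult_eq_reg_r with (c - a); [| lra].
  replace ((b + (x - a) / (c - a) * (d - b)) * (c - a))
    with (b * (c - a) + (x - a) * (d - b)) by (field; lra); lra.
Qed.

Lemma delta_sinh P Q Rv : in_D P -> in_D Q -> in_D Rv -> nondegenerate P Q Rv ->
  0 <= delta P Q Rv /\
  sinh (delta P Q Rv) ^ 2 * (mink Rv Rv * (mink P Q ^ 2 - mink P P * mink Q Q))
  = cross P Q Rv ^ 2.
Proof.
intros HP HQ HR Hnd.
assert (Hne : P <> Q) by (intros ->; apply Hnd; unfold cross; ring).
destruct (dprime_sinh P Q HP HQ Hne) as [Hd Ed].
assert (PP := mink_diag_pos P HP); assert (QQ := mink_diag_pos Q HQ).
assert (RR := mink_diag_pos Rv HR).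
set (N := mink P Q ^ 2 - mink P P * mink Q Q) in *.
assert (HN : 0 < N).
{ rewrite <- Ed; apply Rmult_lt_0_compat; [now apply Rmult_lt_0_compat|].
  apply pow2_gt_0, Rgt_not_eq, sinh_pos, Hd. }
(* [K / N] is the Minkowski square of the projection of [Rv] to the plane spanned by [P] and [Q]. *)
set (K := N * mink Rv Rv + cross P Q Rv ^ 2).
assert (HK : 0 < K)
  by (unfold K; generalize (pow2_ge_0 (cross P Q Rv)); nra).
(* Coordinates, up to the factor [- N], of the projection of [Rv] to the plane
   spanned by [P] and [Q]. *)
set (al := mink P Rv * mink Q Q - mink Q Rv * mink P Q).
set (be := mink Q Rv * mink P P - mink P Rv * mink P Q).
(* Reverse Cauchy-Schwarz between [S] and that projection, with its defect as a perfect square that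
   vanishes at the foot of the perpendicular. *)
assert (Hid : forall S s, fst S = fst P + s * (fst Q - fst P) ->
    snd S = snd P + s * (snd Q - snd P) ->
    N * mink Rv S ^ 2 - mink S S * K = (s * (al + be) - be) ^ 2).
{ intros S s Ex Ey; unfold K, N, al, be, mink, cross; rewrite Ex, Ey; ring. }
(* The last homogeneous coordinate of the projection must not vanish, so that the foot is an affine
   point of the line. *)
assert (Hsum : al + be <> 0).
{ intro E0.
  assert (E : (al + be) ^ 2
     = N * (fst Rv * (fst Q - fst P) + snd Rv * (snd Q - snd P)) ^ 2
       + ((fst Q - fst P) ^ 2 + (snd Q - snd P) ^ 2) * K)
    by (unfold K, N, al, be, mink, cross; ring).
  rewrite E0 in E.
  generalize (pow2_ge_0 (fst Rv * (fst Q - fst P) + snd Rv * (snd Q - snd P)))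
    (pow2_ge_0 (fst Q - fst P)) (pow2_ge_0 (snd Q - snd P)); intros G1 G2 G3.
  assert (E2 : (fst Q - fst P) ^ 2 + (snd Q - snd P) ^ 2 = 0) by nra.
  apply Hne; destruct P, Q; simpl in *; f_equal; nra. }
assert (Hdist : forall S, in_D S -> on_line P Q S ->
   0 < dprime Rv S /\
   mink Rv Rv * mink S S * sinh (dprime Rv S) ^ 2
   = mink Rv S ^ 2 - mink Rv Rv * mink S S).
{ intros S HS HL; apply dprime_sinh; try assumption.
  intros ->; now apply Hnd. }
set (s0 := be / (al + be)).
set (S0 := (fst P + s0 * (fst Q - fst P), snd P + s0 * (snd Q - snd P))).
assert (H0 : N * mink Rv S0 ^ 2 - mink S0 S0 * K = 0).
{ rewrite (Hid S0 s0) by reflexivity; unfold s0; field; exact Hsum. }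
assert (HS0 : in_D S0).
{ assert (Hge : 0 <= mink S0 S0).
  { generalize (pow2_ge_0 (mink Rv S0)); nra. }
  assert (Hm := mink_pos Rv S0 HR Hge).
  assert (0 < mink S0 S0) by (apply pow_lt with (n := 2%nat) in Hm; nra).
  unfold in_D, mink in *; lra. }
assert (HL0 : on_line P Q S0) by (unfold on_line, cross, S0; simpl; ring).
assert (Hsinh : forall S, in_D S -> on_line P Q S ->
   cross P Q Rv ^ 2 <= sinh (dprime Rv S) ^ 2 * (mink Rv Rv * N)).
{ intros S HS HL; destruct (Hdist S HS HL) as [_ E].
  destruct (line_param P Q S Hne HL) as (s & Ex & Ey).
  assert (Hi := Hid S s Ex Ey).
  assert (SS := mink_diag_pos S HS).
  apply Rmult_le_reg_r with (mink S S); [exact SS|].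
  replace (sinh (dprime Rv S) ^ 2 * (mink Rv Rv * N) * mink S S)
    with (N * (mink Rv S ^ 2 - mink Rv Rv * mink S S)) by (rewrite <- E; ring).
  generalize (pow2_ge_0 (s * (al + be) - be)); unfold K in Hi; lra. }
destruct (Hdist S0 HS0 HL0) as [Hpos0 E0].
assert (Hsinh0 : sinh (dprime Rv S0) ^ 2 * (mink Rv Rv * N) = cross P Q Rv ^ 2).
{ assert (SS := mink_diag_pos S0 HS0).
  apply Rmult_eq_reg_r with (mink S0 S0); [| lra].
  transitivity (N * (mink Rv S0 ^ 2 - mink Rv Rv * mink S0 S0));
    [rewrite <- E0; ring | unfold K in H0; lra]. }
assert (HRN : 0 < mink Rv Rv * N) by now apply Rmult_lt_0_compat.
assert (Hmin : is_delta P Q Rv (dprime Rv S0)).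
{ split; [now exists S0|].
  intros S HS HL; apply Rnot_lt_le; intro Hlt.
  destruct (Hdist S HS HL) as [HposS _].
  apply sinh_sqr_lt in Hlt; [| lra | lra].
  specialize (Hsinh S HS HL); nra. }
assert (Hdelta : is_delta P Q Rv (delta P Q Rv))
  by (apply (epsilon_spec (inhabits 0) (is_delta P Q Rv)); eauto).
assert (E : delta P Q Rv = dprime Rv S0).
{ destruct Hdelta as [(S & HS & HL & <-) Hle], Hmin as [_ Hle0].
  apply Rle_antisym; auto. }
rewrite E; split; [lra | exact Hsinh0].
Qed.

Theorem theorem4p2 (P Q Rv : pt) :
  nondegenerate P Q Rv ->
  (forall X, in_triangle P Q Rv X -> in_D X) ->
  (delta P Q Rv < Deltaprime P Q -> 1 / 3 < rho P Q Rv < 1 / 2) /\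
  (delta P Q Rv >= Deltaprime P Q -> rho P Q Rv = 1 / 3).
Proof.
intros Hnd HD; destruct (in_triangle_vertices P Q Rv) as (VP & VQ & VR).
apply HD in VP, VQ, VR.
assert (Hne : P <> Q) by (intros ->; apply Hnd; unfold cross; ring).
destruct (dprime_sinh P Q VP VQ Hne) as [Hd Ed].
destruct (Deltaprime_sinh P Q VP VQ Hne) as [HD0 ED].
destruct (delta_sinh P Q Rv VP VQ VR Hnd) as [Hdel Edel].
destruct (rho_criterion P Q Rv VP VQ VR Hnd) as [Hge Hlt].
set (N := mink P Q ^ 2 - mink P P * mink Q Q) in *.
assert (PP := mink_diag_pos P VP); assert (QQ := mink_diag_pos Q VQ).
assert (RR := mink_diag_pos Rv VR).
assert (HN : 0 < N).
{ rewrite <- Ed; apply Rmult_lt_0_compat; [now apply Rmult_lt_0_compat|].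
  apply pow2_gt_0, Rgt_not_eq, sinh_pos, Hd. }
assert (HRN : 0 < mink Rv Rv * N) by now apply Rmult_lt_0_compat.
(* With the common positive factor [mink Rv Rv * N], the squared [sinh] of [delta] and of
   [Deltaprime] become the two sides compared in [rho_criterion]. *)
assert (EDel : sinh (Deltaprime P Q) ^ 2 * (mink Rv Rv * N)
               = mink P P * mink Q Q * mink Rv Rv).
{ rewrite <- Ed.
  transitivity ((sinh (Deltaprime P Q) * sinh (dprime P Q)) ^ 2
                * (mink P P * mink Q Q * mink Rv Rv)); [ring | rewrite ED; ring]. }
split; intro H.
- apply Hlt; rewrite <- Edel, <- EDel; apply Rmult_lt_compat_r; [exact HRN|].
  apply sinh_sqr_lt; lra.
- apply Hge; rewrite <- Edel, <- EDel; apply Rmult_le_compat_r; [lra|].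
  apply Rnot_lt_le; intro Hl.
  apply (proj1 (sinh_sqr_lt (delta P Q Rv) (Deltaprime P Q) Hdel ltac:(lra))) in Hl.
  lra.
Qed.
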